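(* Let $c_{n\ell}$ ($n=1,2$; $\ell=1,2,3$), $\bar z_1,\bar z_2$ and $\eta\neq0$ be a priori arbitrary (possibly complex) parameters, and consider the systems $$\dot x_n(t)=c_{n1}[x_1(t)]^2+c_{n2}x_1(t)x_2(t)+c_{n3}[x_2(t)]^2,\quad n=1,2, \tag{S}$$ $$\dot z_n(t)=c_{n1}[z_1(t)]^2+c_{n2}z_1(t)z_2(t)+c_{n3}[z_2(t)]^2+\eta z_n(t)+d_{n1}z_1(t)+d_{n2}z_2(t)+d_{n3},\quad n=1,2, \tag{Z}$$ where, for $n=1,2$, $$d_{n1}=-2c_{n1}\bar z_1-c_{n2}\bar z_2,\qquad d_{n2}=-2c_{n3}\bar z_2-c_{n2}\bar z_1,\qquad d_{n3}=-\eta\bar z_n+c_{n1}\bar z_1^2+c_{n2}\bar z_1\bar z_2+c_{n3}\bar z_2^2 .$$ (i) The (easily invertible) change of variables $$z_n(t)=e^{\eta t}\,x_n(\tilde t)+\bar z_n,\qquad \tilde t=\frac{e^{\eta t}-1}{\eta},\qquad n=1,2,$$ transforms the system (S) into the system (Z); the solvability properties of (S) carry over to (Z). (ii) Suppose moreover that there are parameters $\rho_1,\rho_2$ and $b_{nm}$ ($n,m\in\{1,2\}$) with $B=b_{11}b_{22}-b_{12}b_{21}\ne0$ such that, setting $a_{11}=b_{22}/B$, $a_{12}=-b_{12}/B$, $a_{21}=-b_{21}/B$, $a_{22}=b_{11}/B$, one has for $n=1,2$ $$c_{n1}=b_{n1}a_{11}^2+b_{n2}\left[\rho_1a_{11}^2+(\rho_2a_{11}+a_{21})a_{21}\right],$$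 $$c_{n2}=2b_{n1}a_{11}a_{12}+b_{n2}\left[2\rho_1a_{11}a_{12}+\rho_2(a_{11}a_{22}+a_{12}a_{21})+2a_{21}a_{22}\right],$$ $$c_{n3}=b_{n1}a_{12}^2+b_{n2}\left[\rho_1a_{12}^2+(\rho_2a_{12}+a_{22})a_{22}\right],$$ and such that $\Delta=\sqrt{(1-\rho_2)^2-4\rho_1}$ is a real rational number, $\Delta=k_1/k_2$ with $k_1$ an arbitrary integer and $k_2$ an arbitrary positive integer. Let $\eta=\mathbf{i}\omega$ with $\omega$ an arbitrary nonvanishing real number. Then the system (Z) is isochronous: all its solutions $z_n(t)$ are periodic with the same period $T=2\pi k_2/|\omega|$, $$z_n(t+T)=z_n(t),\quad n=1,2.$$
   Context: Dots denote differentiation with respect to the argument, $t$ is thought of as time, and $\mathbf{i}$ is the imaginary unit; dependent variables and parameters may be complex, and the functions $x_n$ are also considered at complex values of their argument, by analytic continuation. The condition on $c_{n\ell}$ in (ii) says that (S) is obtained from the explicitly solvable system $\dot y_1=y_1^2$, $\dot y_2=\rho_1y_1^2+\rho_2y_1y_2+y_2^2$ by the invertible linear change $x_n=b_{n1}y_1+b_{n2}y_2$, $n=1,2$ (equivalently $y_n=a_{n1}x_1+a_{n2}x_2$). A system is called solvable (explicitly) when the solution of its initial-values problem can be exhibited as an elementary function of the independent variable, with parameters given by explicit formulas in terms of the original parameters of the system.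
   Formalization: In (ii) the integer k_1 is required to be nonzero (Δ≠0): for Δ=0 the claim fails, e.g. ż_1=z_1²+i z_1, ż_2=z_1z_2+z_2²+i z_2 (ρ_1=0, ρ_2=1, ω=1) has the nonperiodic solution z_1=-i, z_2=-1/(t+i). *)

(* Defs.v *)
From Stdlib Require Import Reals ZArith.
From Coquelicot Require Import Coquelicot.
Open Scope C_scope.

(** Index sets [{1,2}] and [{1,2,3}]. *)
Inductive I2 : Set := n1 | n2.
Inductive I3 : Set := l1 | l2 | l3.

(** Right-hand sides of the two systems, as maps from C^2 to C^2. *)

Definition rhsS (c : I2 -> I3 -> C) (x : I2 -> C) (n : I2) : C :=
  c n l1 * x n1 ^ 2 + c n l2 * (x n1 * x n2) + c n l3 * x n2 ^ 2.

Definition dcoef (c : I2 -> I3 -> C) (zbar : I2 -> C) (eta : C)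
    (n : I2) (l : I3) : C :=
  match l with
  | l1 => - (2 * c n l1 * zbar n1) - c n l2 * zbar n2
  | l2 => - (2 * c n l3 * zbar n2) - c n l2 * zbar n1
  | l3 => - (eta * zbar n)
          + (c n l1 * zbar n1 ^ 2 + c n l2 * (zbar n1 * zbar n2)
             + c n l3 * zbar n2 ^ 2)
  end.

Definition rhsZ (c : I2 -> I3 -> C) (zbar : I2 -> C) (eta : C)
    (z : I2 -> C) (n : I2) : C :=
  c n l1 * z n1 ^ 2 + c n l2 * (z n1 * z n2) + c n l3 * z n2 ^ 2
  + eta * z n
  + dcoef c zbar eta n l1 * z n1 + dcoef c zbar eta n l2 * z n2
  + dcoef c zbar eta n l3.

(** [x] satisfies [x' = f x] at the point [t], for a complex (resp. real)
    independent variable; differentiability at [t] is part of the claim. *)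

Definition solves_at (f : (I2 -> C) -> I2 -> C) (x : I2 -> C -> C) (t : C)
    : Prop :=
  forall n, is_derive (K := C_AbsRing) (V := C_NormedModule)
              (x n) t (f (fun m => x m t) n).

Definition solves_at_real (f : (I2 -> C) -> I2 -> C) (x : I2 -> R -> C) (t : R)
    : Prop :=
  forall n, is_derive (K := R_AbsRing) (V := C_R_NormedModule)
              (x n) t (f (fun m => x m t) n).

Definition Cexp (z : C) : C :=
  (exp (Re z) * cos (Im z), exp (Re z) * sin (Im z))%R.

Definition ttilde (eta t : C) : C := (Cexp (eta * t) - 1) / eta.

Definition change (zbar : I2 -> C) (eta : C) (x : I2 -> C -> C)
    (n : I2) (t : C) : C :=
  Cexp (eta * t) * x n (ttilde eta t) + zbar n.

(** Formal expressions for elementary functions, over variables in [X].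
    [FRoot d a] stands for a root [w] of
    [w ^ (d + 1) + a d w ^ d + ... + a 0 = 0]. *)

Inductive formula (X : Type) : Type :=
| FVar (v : X)
| FCst (k : C)
| FAdd (e1 e2 : formula X)
| FMul (e1 e2 : formula X)
| FInv (e : formula X)
| FExp (e : formula X)
| FLog (e : formula X)
| FRoot (d : nat) (a : nat -> formula X).

(** [denotes U env e f]: on the domain [U], [f] is a continuous branch of the
    possibly multivalued function of one complex variable denoted by [e], when
    each variable [v] is replaced by the function [env v].  [FLog] and [FRoot]
    are the multivalued constructors; [FInv] can only be applied to functions
    without zeros in [U]. *)

Fixpoint denotes {X : Type} (U : C -> Prop) (env : X -> C -> C)
    (e : formula X) (f : C -> C) {struct e} : Prop :=
  match e with
  | FVar v => forall t, U t -> f t = env v t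
  | FCst k => forall t, U t -> f t = k
  | FAdd e1 e2 => exists g1 g2, denotes U env e1 g1 /\ denotes U env e2 g2 /\
      forall t, U t -> f t = g1 t + g2 t
  | FMul e1 e2 => exists g1 g2, denotes U env e1 g1 /\ denotes U env e2 g2 /\
      forall t, U t -> f t = g1 t * g2 t
  | FInv e1 => exists g, denotes U env e1 g /\
      forall t, U t -> f t * g t = 1
  | FExp e1 => exists g, denotes U env e1 g /\
      forall t, U t -> f t = Cexp (g t)
  | FLog e1 => exists g, denotes U env e1 g /\
      (forall t, U t -> continuous f t) /\
      forall t, U t -> Cexp (f t) = g t
  | FRoot d a => exists g : nat -> C -> C,
      (forall i, (i <= d)%nat -> denotes U env (a i) (g i)) /\
      (forall t, U t -> continuous f t) /\
      forall t, U t ->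
        f t ^ S d + sum_n (fun i => g i t * f t ^ i) d = 0
  end.

Definition opendisc (t0 : C) (r : R) (t : C) : Prop := (Cmod (t - t0) < r)%R.

(** Variables of a solution formula: time, the parameters of the system
    (indexed by [V]) and the initial values. *)

Inductive sol_var (V : Type) : Type :=
| VTime
| VPar (v : V)
| VInit (n : I2).

Definition sol_env {V : Type} (p : V -> C) (x0 : I2 -> C) (v : sol_var V)
    (t : C) : C :=
  match v with
  | VTime => t
  | VPar v => p v
  | VInit n => x0 n
  end.

(** Explicit solvability of the family of systems [x' = f p x], for the
    parameter values [p] and initial values [x0] such that [D p x0]: one
    elementary formula in the time, the parameters and the initial values
    gives the solution of every initial-values problem.  It is required to do
    so in a disc about the initial time, hence by analytic continuation
    wherever the solution can be continued. *)

Definition solvable {V : Type} (f : (V -> C) -> (I2 -> C) -> I2 -> C)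
    (D : (V -> C) -> (I2 -> C) -> Prop) : Prop :=
  exists F : I2 -> formula (sol_var V),
  forall p x0, D p x0 ->
  exists (r : R) (x : I2 -> C -> C), (0 < r)%R /\
    (forall n, x n 0 = x0 n) /\
    (forall t, opendisc 0 r t -> solves_at (f p) x t) /\
    (forall n, denotes (opendisc 0 r) (sol_env p x0) (F n) (x n)).

Inductive parS : Set := Sc (n : I2) (l : I3).
Inductive parZ : Set := Zc (n : I2) (l : I3) | Zbar (n : I2) | Zeta.

Definition familyS (p : parS -> C) : (I2 -> C) -> I2 -> C :=
  rhsS (fun n l => p (Sc n l)).

Definition familyZ (p : parZ -> C) : (I2 -> C) -> I2 -> C :=
  rhsZ (fun n l => p (Zc n l)) (fun n => p (Zbar n)) (p Zeta).

(** The data for the second family that correspond to data [D] for the first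
    one; [change] maps the initial value [x0] to [x0 + zbar]. *)

Definition dataZ (D : (parS -> C) -> (I2 -> C) -> Prop)
    (p : parZ -> C) (z0 : I2 -> C) : Prop :=
  p Zeta <> 0 /\
  D (fun q => match q with Sc n l => p (Zc n l) end)
    (fun n => z0 n - p (Zbar n)).

Definition matA (b : I2 -> I2 -> C) (n m : I2) : C :=
  let B := b n1 n1 * b n2 n2 - b n1 n2 * b n2 n1 in
  match n, m with
  | n1, n1 => b n2 n2 / B
  | n1, n2 => - b n1 n2 / B
  | n2, n1 => - b n2 n1 / B
  | n2, n2 => b n1 n1 / B
  end.

Definition coefC (rho1 rho2 : C) (b : I2 -> I2 -> C) (n : I2) (l : I3) : C :=
  let a11 := matA b n1 n1 in
  let a12 := matA b n1 n2 in
  let a21 := matA b n2 n1 in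
  let a22 := matA b n2 n2 in
  match l with
  | l1 => b n n1 * a11 ^ 2
          + b n n2 * (rho1 * a11 ^ 2 + (rho2 * a11 + a21) * a21)
  | l2 => 2 * b n n1 * a11 * a12
          + b n n2 * (2 * rho1 * a11 * a12
                      + rho2 * (a11 * a22 + a12 * a21) + 2 * a21 * a22)
  | l3 => b n n1 * a12 ^ 2
          + b n n2 * (rho1 * a12 ^ 2 + (rho2 * a12 + a22) * a22)
  end.

(** All solutions of [z' = f z] have period [T].  The first clause is about
    solutions on an arbitrary, possibly unbounded, open interval of real times.
    The second one is about solutions with singularities at real times,
    continued analytically past them through complex times: such a solution is
    given on one side of the real axis, near it ([sg > 0]: above; [sg < 0]:
    below), and is evaluated at those real times where it is regular. *)

Definition isochronous (f : (I2 -> C) -> I2 -> C) (T : R) : Prop :=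
  (forall (a b : Rbar) (z : I2 -> R -> C),
     (forall t : R, Rbar_lt a t -> Rbar_lt t b -> solves_at_real f z t) ->
     forall t : R, Rbar_lt a t -> Rbar_lt (t + T)%R b ->
     forall n, z n (t + T)%R = z n t) /\
  (forall (sg : R) (z : I2 -> C -> C), sg <> 0%R ->
     (forall s : R, exists delta : R, (0 < delta)%R /\
        forall t : C, opendisc s delta t -> (0 < sg * Im t)%R -> solves_at f z t) ->
     forall t : R, solves_at f z t -> solves_at f z (t + T)%R ->
     forall n, z n (t + T)%R = z n t).

(* Main.v *)
Require Import Defs.
From Stdlib Require Import Reals ZArith Lra Lia Classical ClassicalEpsilon.
From Coquelicot Require Import Coquelicot.
Open Scope C_scope.

(** The change of variables.  Write E = exp (eta t), so that the derivative of
    ttilde is E.  If z = E x(ttilde) + zbar, the coefficients d are such that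
    the right-hand side of (Z) at z is eta E x + E^2 times the right-hand side
    of (S) at x ([rhsZ_change]), which is what the chain rule gives for the
    derivative of z.  Since ttilde has the local inverse
    y |-> t0 + Log ((1 + eta y) / exp (eta t0)) / eta, the argument can be
    reversed, and the change of variables is locally invertible.

    Solvability.  A formula for the solutions of (S) becomes one for (Z) by
    substituting formulas for ttilde and for the shifted initial values
    ([denotes_subst]).

    Isochrony.  On the real line, x = (z - zbar) / E satisfies x' = E times the
    quadratic field of (S), and a linear change leads to
      y1' = E y1^2,   y2' = E (rho1 y1^2 + rho2 y1 y2 + y2^2).
    Let p = 2 PI / |omega| be the period of E.  The derivative of
    1 / y1 + E / eta is zero, so y1 has period p, as long as it exists
    ([riccati_periodic]).  With J' = E y1 one has y1(s) = y1(t) exp (J(s) - J(t)),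
    so J grows over one period by a number m with exp m = 1, and over
    k2 periods by k2 m.  The linear forms Y+ and Y- = y2 - v y1, with v the two
    roots (1 - rho2 + Delta) / 2 and (1 - rho2 - Delta) / 2, satisfy
      Y+' = E (Y- + y1) Y+,   Y-' = E (Y+ + y1) Y-,
    two linear equations whose coefficients differ by Delta J'.  Over k2 periods
    Delta J grows by k1 m, and exp (k1 m) = 1: hence Y+ and Y- are multiplied by
    the same factor.  So is their difference Delta y1 up to sign, which is
    periodic; the factor is 1 unless y1 vanishes identically, and then
    y2' = E y2^2, which is the first case again ([planar_periodic]).

    Solutions that are continued past real singularities exist on a strip on
    one side of any compact piece of the real axis.  The equation being
    autonomous, they are periodic on the horizontal lines of this strip, and
    the lines tend to the real axis ([continued_periodic]). *)

(** * Limits and derivatives along a subset of the complex plane *)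

Definition tends (S : C -> Prop) (f : C -> C) (z l : C) : Prop :=
  forall eps : R, (0 < eps)%R -> exists delta : R, (0 < delta)%R /\
    forall w, S w -> (Cmod (w - z) < delta)%R -> (Cmod (f w - l) < eps)%R.

(** Caratheodory's form of differentiability: the slope [q] has the limit [l].
    With [S] the whole plane this is the complex derivative, with [S] the real
    axis the derivative in a real time, so that the rules of calculus need only
    one proof.  The form without quotients makes them algebraic identities. *)
Definition deriv_in (S : C -> Prop) (f : C -> C) (z l : C) : Prop :=
  exists q : C -> C, tends S q z l /\ forall w, S w -> f w = f z + (w - z) * q w.

Lemma tends_ext (S : C -> Prop) (f g : C -> C) (z l : C) :
  (forall w, S w -> f w = g w) -> tends S f z l -> tends S g z l.
Proof.
  intros Hfg Hf eps Heps. destruct (Hf eps Heps) as [d [Hd H]].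
  exists d; split; [exact Hd|]. intros w Sw Hw. rewrite <- Hfg by exact Sw. auto.
Qed.

Lemma tends_const (S : C -> Prop) (k z : C) : tends S (fun _ => k) z k.
Proof.
  intros eps Heps. exists 1%R; split; [lra|]. intros w _ _.
  replace (k - k) with (RtoC 0) by ring. rewrite Cmod_0. exact Heps.
Qed.

Lemma tends_id (S : C -> Prop) (z : C) : tends S (fun w => w) z z.
Proof. intros eps Heps. exists eps; auto. Qed.

Lemma tends_plus (S : C -> Prop) (f g : C -> C) (z l m : C) :
  tends S f z l -> tends S g z m -> tends S (fun w => f w + g w) z (l + m).
Proof.
  intros Hf Hg eps Heps.
  destruct (Hf (eps / 2)%R) as [d1 [Hd1 H1]]; [lra|].
  destruct (Hg (eps / 2)%R) as [d2 [Hd2 H2]]; [lra|].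
  exists (Rmin d1 d2); split; [now apply Rmin_glb_lt|]. intros w Sw Hw.
  assert (A1 := H1 w Sw (Rlt_le_trans _ _ _ Hw (Rmin_l _ _))).
  assert (A2 := H2 w Sw (Rlt_le_trans _ _ _ Hw (Rmin_r _ _))).
  replace (f w + g w - (l + m)) with ((f w - l) + (g w - m)) by ring.
  eapply Rle_lt_trans; [apply Cmod_triangle|]. lra.
Qed.

Lemma tends_mult (S : C -> Prop) (f g : C -> C) (z l m : C) :
  tends S f z l -> tends S g z m -> tends S (fun w => f w * g w) z (l * m).
Proof.
  intros Hf Hg eps Heps.
  assert (Pl := Cmod_ge_0 l). assert (Pm := Cmod_ge_0 m).
  set (K := (2 + Cmod l + Cmod m)%R).
  assert (HK : (0 < K)%R) by (unfold K; lra).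
  set (e := Rmin 1 (eps / K)).
  assert (He : (0 < e)%R).
  { apply Rmin_glb_lt; [lra|]. now apply Rdiv_lt_0_compat. }
  assert (He1 : (e <= 1)%R) by apply Rmin_l.
  assert (HeK : (e * K <= eps)%R).
  { apply Rle_trans with (eps / K * K)%R.
    - apply Rmult_le_compat_r; [lra|apply Rmin_r].
    - right. field. lra. }
  destruct (Hf e He) as [d1 [Hd1 H1]]. destruct (Hg e He) as [d2 [Hd2 H2]].
  exists (Rmin d1 d2); split; [now apply Rmin_glb_lt|]. intros w Sw Hw.
  assert (A1 := H1 w Sw (Rlt_le_trans _ _ _ Hw (Rmin_l _ _))).
  assert (A2 := H2 w Sw (Rlt_le_trans _ _ _ Hw (Rmin_r _ _))).
  replace (f w * g w - l * m)
    with ((f w - l) * (g w - m) + ((f w - l) * m + l * (g w - m))) by ring.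
  eapply Rle_lt_trans; [apply Cmod_triangle|].
  eapply Rle_lt_trans; [apply Rplus_le_compat_l, Cmod_triangle|].
  rewrite !Cmod_mult.
  assert (P1 := Cmod_ge_0 (f w - l)). assert (P2 := Cmod_ge_0 (g w - m)).
  unfold K in HeK. nra.
Qed.

Lemma tends_inv (S : C -> Prop) (f : C -> C) (z l : C) :
  l <> 0 -> tends S f z l -> tends S (fun w => / f w) z (/ l).
Proof.
  intros Hl Hf eps Heps.
  assert (Pl := proj1 (Cmod_gt_0 l) Hl).
  set (e := Rmin (Cmod l / 2) (eps * (Cmod l * Cmod l) / 2)).
  assert (He : (0 < e)%R).
  { apply Rmin_glb_lt; [lra|]. assert (0 < Cmod l * Cmod l)%R by nra. nra. }
  destruct (Hf e He) as [d [Hd H]]. exists d; split; [exact Hd|].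
  intros w Sw Hw. assert (A := H w Sw Hw).
  assert (A1 := Rlt_le_trans _ _ _ A (Rmin_l _ _)).
  assert (A2 := Rlt_le_trans _ _ _ A (Rmin_r _ _)).
  assert (B : (Cmod l / 2 < Cmod (f w))%R).
  { assert (T := Cmod_triangle (f w) (- (f w - l))).
    replace (f w + - (f w - l)) with l in T by ring.
    rewrite Cmod_opp in T. lra. }
  assert (Hfw : f w <> 0) by (apply Cmod_gt_0; lra).
  replace (/ f w - / l) with (- (f w - l) * / (f w * l)) by (field; auto).
  rewrite Cmod_mult, Cmod_opp, Cmod_inv, Cmod_mult.
  2: now apply Cmult_neq_0.
  apply Rmult_lt_reg_r with (Cmod (f w) * Cmod l)%R; [nra|].
  rewrite Rmult_assoc, Rinv_l, Rmult_1_r by nra.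
  eapply Rlt_le_trans; [exact A2|].
  assert (Cmod l / 2 * (eps * Cmod l) <= Cmod (f w) * (eps * Cmod l))%R.
  { apply Rmult_le_compat_r; nra. } nra.
Qed.

Lemma tends_comp (S S' : C -> Prop) (f g : C -> C) (z l m : C) :
  (forall w, S w -> S' (f w)) ->
  tends S f z l -> tends S' g l m -> tends S (fun w => g (f w)) z m.
Proof.
  intros HS Hf Hg eps Heps. destruct (Hg eps Heps) as [d [Hd H]].
  destruct (Hf d Hd) as [d' [Hd' H']]. exists d'; split; auto.
Qed.

Lemma deriv_in_tends (S : C -> Prop) (f : C -> C) (z l : C) :
  deriv_in S f z l -> tends S f z (f z).
Proof.
  intros [q [Hq Hf]].
  apply tends_ext with (fun w => f z + (w + - z) * q w).
  { intros w Sw. symmetry. now apply Hf. }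
  assert (H : tends S (fun w => f z + (w + - z) * q w) z (f z + (z + - z) * l)).
  { apply tends_plus; [apply tends_const|].
    apply tends_mult; [|exact Hq].
    apply tends_plus; [apply tends_id|apply tends_const]. }
  now replace (f z + (z + - z) * l) with (f z) in H by ring.
Qed.

Lemma deriv_in_ext (S : C -> Prop) (f g : C -> C) (z l l' : C) :
  (forall w, S w -> f w = g w) -> f z = g z -> l = l' ->
  deriv_in S f z l -> deriv_in S g z l'.
Proof.
  intros H Hz <- [q [Hq Hf]]. exists q; split; [exact Hq|].
  intros w Sw. rewrite <- H, <- Hz by exact Sw. auto.
Qed.

Lemma deriv_in_sub (S S' : C -> Prop) (f : C -> C) (z l : C) :
  (forall w, S w -> S' w) -> deriv_in S' f z l -> deriv_in S f z l.
Proof.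
  intros H [q [Hq Hf]]. exists q; split; [|auto].
  intros eps Heps. destruct (Hq eps Heps) as [d [Hd Hd']]. exists d; auto.
Qed.

Lemma deriv_in_const (S : C -> Prop) (k z : C) : deriv_in S (fun _ => k) z 0.
Proof. exists (fun _ => 0). split; [apply tends_const|]. intros; ring. Qed.

Lemma deriv_in_id (S : C -> Prop) (z : C) : deriv_in S (fun w => w) z 1.
Proof. exists (fun _ => 1). split; [apply tends_const|]. intros; ring. Qed.

Lemma deriv_in_plus (S : C -> Prop) (f g : C -> C) (z l m : C) :
  deriv_in S f z l -> deriv_in S g z m ->
  deriv_in S (fun w => f w + g w) z (l + m).
Proof.
  intros [q [Hq Hf]] [q' [Hq' Hg]]. exists (fun w => q w + q' w).
  split; [now apply tends_plus|]. intros w Sw. rewrite Hf, Hg by exact Sw. ring.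
Qed.

Lemma deriv_in_mult (S : C -> Prop) (f g : C -> C) (z l m : C) :
  deriv_in S f z l -> deriv_in S g z m ->
  deriv_in S (fun w => f w * g w) z (l * g z + f z * m).
Proof.
  intros Df Dg. assert (Cg := deriv_in_tends _ _ _ _ Dg).
  destruct Df as [q [Hq Hf]]; destruct Dg as [q' [Hq' Hg]].
  exists (fun w => q w * g w + f z * q' w). split.
  - apply tends_plus; apply tends_mult; auto. apply tends_const.
  - intros w Sw. rewrite (Hf w Sw).
    replace ((f z + (w - z) * q w) * g w) with (f z * g w + (w - z) * q w * g w)
      by ring.
    rewrite (Hg w Sw) at 1. ring.
Qed.

Lemma deriv_in_scal (S : C -> Prop) (k : C) (f : C -> C) (z l : C) :
  deriv_in S f z l -> deriv_in S (fun w => k * f w) z (k * l).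
Proof.
  intros H.
  apply deriv_in_ext with (f := fun w => k * f w) (l := 0 * f z + k * l); auto.
  { ring. }
  exact (deriv_in_mult _ _ _ _ _ _ (deriv_in_const S k z) H).
Qed.

Lemma deriv_in_comp (S S' : C -> Prop) (f g : C -> C) (z l m : C) :
  (forall w, S w -> S' (f w)) ->
  deriv_in S f z l -> deriv_in S' g (f z) m ->
  deriv_in S (fun w => g (f w)) z (m * l).
Proof.
  intros HS Df Dg. assert (Cf := deriv_in_tends _ _ _ _ Df).
  destruct Df as [q [Hq Hf]]; destruct Dg as [q' [Hq' Hg]].
  exists (fun w => q' (f w) * q w). split.
  - apply tends_mult; [|exact Hq]. now apply tends_comp with (S' := S') (l := f z).
  - intros w Sw. rewrite (Hg (f w)) by auto. rewrite (Hf w Sw) at 1. ring.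
Qed.

(** The slope of [g] at [w] is the inverse of the slope of [f] at [g w], which has
    a limit because [g] is continuous at [y]. *)
Lemma deriv_in_inverse (S S' : C -> Prop) (f g : C -> C) (y l : C) :
  (forall w, S' w -> S (g w)) -> (forall w, S' w -> f (g w) = w) ->
  f (g y) = y -> tends S' g y (g y) -> l <> 0 -> deriv_in S f (g y) l ->
  deriv_in S' g y (/ l).
Proof.
  intros HS Hfg Hy Cg Hl [q [Hq Hf]].
  exists (fun w => / q (g w)). split.
  - apply tends_inv; [exact Hl|].
    now apply tends_comp with (S' := S) (l := g y).
  - intros w Sw. assert (E := Hf (g w) (HS w Sw)).
    rewrite (Hfg w Sw), Hy in E.
    destruct (classic (g w = g y)) as [e|n].
    + assert (Ew : w = y) by (rewrite <- (Hfg w Sw), e; exact Hy).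
      rewrite Ew. unfold Cminus. rewrite Cplus_opp_r. ring.
    + assert (Hqn : q (g w) <> 0).
      { intro Q. rewrite Q, Cmult_0_r, Cplus_0_r in E. apply n. now rewrite E. }
      rewrite E at 2.
      replace (y + (g w - g y) * q (g w) - y) with ((g w - g y) * q (g w)) by ring.
      field. exact Hqn.
Qed.

(** The quotient-free error estimate, in which Coquelicot states
    differentiability. *)
Lemma deriv_in_eps (S : C -> Prop) (f : C -> C) (z l : C) :
  deriv_in S f z l <->
  forall eps : R, (0 < eps)%R -> exists delta : R, (0 < delta)%R /\
    forall w, S w -> (Cmod (w - z) < delta)%R ->
      (Cmod (f w - f z - (w - z) * l) <= eps * Cmod (w - z))%R.
Proof.
  split.
  - intros [q [Hq Hf]] eps Heps. destruct (Hq eps Heps) as [d [Hd H]].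
    exists d; split; [exact Hd|]. intros w Sw Hw.
    replace (f w - f z - (w - z) * l) with ((w - z) * (q w - l))
      by (rewrite (Hf w Sw); ring).
    rewrite Cmod_mult, Rmult_comm.
    apply Rmult_le_compat_r; [apply Cmod_ge_0|]. left; auto.
  - intros H.
    exists (fun w => if excluded_middle_informative (w = z) then l
                     else (f w - f z) / (w - z)).
    split.
    + intros eps Heps. destruct (H (eps / 2)%R) as [d [Hd Hd']]; [lra|].
      exists d; split; [exact Hd|]. intros w Sw Hw.
      destruct (excluded_middle_informative (w = z)) as [e|n].
      * replace (l - l) with (RtoC 0) by ring. now rewrite Cmod_0.
      * assert (N : w - z <> 0).
        { intro N. apply n. replace w with (w - z + z) by ring. now rewrite N, Cplus_0_l. }
        assert (P := proj1 (Cmod_gt_0 _) N).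
        replace ((f w - f z) / (w - z) - l)
          with ((f w - f z - (w - z) * l) * / (w - z)) by (field; auto).
        rewrite Cmod_mult, Cmod_inv by auto.
        apply Rle_lt_trans with (eps / 2 * Cmod (w - z) * / Cmod (w - z))%R.
        -- apply Rmult_le_compat_r; [left; now apply Rinv_0_lt_compat|auto].
        -- rewrite Rmult_assoc, Rinv_r by lra. lra.
    + intros w Sw. destruct (excluded_middle_informative (w = z)) as [e|n].
      * rewrite e. ring.
      * field. intro N. apply n. replace w with (w - z + z) by ring. now rewrite N, Cplus_0_l.
Qed.

Lemma is_derive_C_eps (f : C -> C) (z l : C) :
  is_derive (K := C_AbsRing) (V := C_NormedModule) f z l <->
  forall eps : R, (0 < eps)%R -> exists delta : R, (0 < delta)%R /\
    forall w, (Cmod (w - z) < delta)%R ->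
      (Cmod (f w - f z - (w - z) * l) <= eps * Cmod (w - z))%R.
Proof.
  split.
  - intros [_ H] eps Heps.
    destruct (H z (fun P Q => Q) (mkposreal eps Heps)) as [d Hd].
    exists d; split; [apply cond_pos|]. intros w Hw. exact (Hd w Hw).
  - intros H. split; [apply is_linear_scal_l|].
    intros z' Hz' eps. destruct (H eps (cond_pos eps)) as [d [Hd Hd']].
    apply (is_filter_lim_locally_unique (V := AbsRing_NormedModule C_AbsRing)) in Hz'.
    subst z'.
    exists (mkposreal d Hd). intros w Hw. exact (Hd' w Hw).
Qed.

Lemma is_derive_R_eps (f : R -> C) (t : R) (l : C) :
  is_derive (K := R_AbsRing) (V := C_R_NormedModule) f t l <->
  forall eps : R, (0 < eps)%R -> exists delta : R, (0 < delta)%R /\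
    forall s : R, (Rabs (s - t) < delta)%R ->
      (Cmod (f s - f t - (RtoC s - RtoC t) * l) <= eps * Rabs (s - t))%R.
Proof.
  assert (E : forall s : R, norm (K := R_AbsRing) (V := C_R_NormedModule)
     (minus (minus (f s) (f t)) (scal (K := R_AbsRing) (minus s t) l)) =
     Cmod (f s - f t - (RtoC s - RtoC t) * l)).
  { intros s. unfold norm; simpl. unfold prod_norm; simpl.
    unfold Cmod, minus, plus, opp, scal; simpl.
    unfold prod_scal, scal, mult; simpl. unfold mult, abs; simpl.
    unfold norm; simpl. unfold abs; simpl.
    assert (Q : forall u v : R, u = v ->
      (Rabs u * (Rabs u * 1) = v * (v * 1))%R).
    { intros u v <-. rewrite !Rmult_1_r. symmetry. apply Rsqr_abs. }
    f_equal. f_equal; apply Q; ring. }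
  split.
  - intros [_ H] eps Heps.
    destruct (H t (fun P Q => Q) (mkposreal eps Heps)) as [d Hd].
    exists d; split; [apply cond_pos|]. intros w Hw. rewrite <- E. exact (Hd w Hw).
  - intros H. split; [apply is_linear_scal_l|].
    intros z' Hz' eps. destruct (H eps (cond_pos eps)) as [d [Hd Hd']].
    apply (is_filter_lim_locally_unique (V := R_NormedModule)) in Hz'. subst z'.
    exists (mkposreal d Hd). intros w Hw.
    specialize (Hd' w Hw). rewrite <- E in Hd'. exact Hd'.
Qed.

(** Differentiability at [z] only concerns a disc about [z]. *)
Lemma is_derive_C_deriv_in (S : C -> Prop) (f : C -> C) (z l : C) (r : R) :
  (0 < r)%R -> (forall w, opendisc z r w -> S w) ->
  is_derive (K := C_AbsRing) (V := C_NormedModule) f z l <-> deriv_in S f z l.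
Proof.
  intros Hr HS. rewrite is_derive_C_eps, deriv_in_eps.
  split; intros H eps Heps; destruct (H eps Heps) as [d [Hd Hd']].
  - exists d; auto.
  - exists (Rmin d r); split; [now apply Rmin_glb_lt|]. intros w Hw. apply Hd'.
    + apply HS. exact (Rlt_le_trans _ _ _ Hw (Rmin_r _ _)).
    + exact (Rlt_le_trans _ _ _ Hw (Rmin_l _ _)).
Qed.

Definition anywhere (w : C) : Prop := True.
Definition on_reals (w : C) : Prop := Im w = 0%R.

Lemma is_derive_C_anywhere (f : C -> C) (z l : C) :
  is_derive (K := C_AbsRing) (V := C_NormedModule) f z l <->
  deriv_in anywhere f z l.
Proof.
  apply is_derive_C_deriv_in with (r := 1%R); [lra|]. intros; exact I.
Qed.

Lemma on_reals_RtoC (w : C) : on_reals w -> w = RtoC (Re w).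
Proof. destruct w as [u v]. unfold on_reals; simpl. now intros ->. Qed.

Lemma RtoC_minus_Cmod (s t : R) : Cmod (s - t) = Rabs (s - t).
Proof. now rewrite <- RtoC_minus, Cmod_R. Qed.

Lemma is_derive_R_on_reals (f : C -> C) (t : R) (l : C) :
  is_derive (K := R_AbsRing) (V := C_R_NormedModule) (fun s : R => f s) t l <->
  deriv_in on_reals f t l.
Proof.
  rewrite is_derive_R_eps, deriv_in_eps.
  split; intros H eps Heps; destruct (H eps Heps) as [d [Hd Hd']];
    exists d; (split; [exact Hd|]).
  - intros w Sw. rewrite (on_reals_RtoC w Sw), RtoC_minus_Cmod. apply Hd'.
  - intros s Hs. rewrite <- RtoC_minus_Cmod in *. now apply Hd'.
Qed.

Lemma deriv_in_reals_unique (f : C -> C) (t : R) (l l' : C) :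
  deriv_in on_reals f t l -> deriv_in on_reals f t l' -> l = l'.
Proof.
  intros H H'. rewrite deriv_in_eps in H, H'.
  destruct (classic (l = l')) as [e|n]; [exact e|exfalso].
  assert (N : l' - l <> 0).
  { intro N. apply n. replace l' with (l' - l + l) by ring.
    now rewrite N, Cplus_0_l. }
  apply Cmod_gt_0 in N. set (e := (Cmod (l' - l) / 4)%R).
  assert (He : (0 < e)%R) by (unfold e; lra).
  destruct (H e He) as [d [Hd A]]. destruct (H' e He) as [d' [Hd' A']].
  set (h := (Rmin d d' / 2)%R).
  assert (Hm : (0 < Rmin d d')%R) by now apply Rmin_glb_lt.
  assert (Hh : (0 < h)%R) by (unfold h; lra).
  assert (Eh : RtoC (t + h) - t = h) by (rewrite <- RtoC_minus; f_equal; ring).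
  assert (Mh : Cmod (RtoC (t + h) - t) = h)
    by (rewrite Eh, Cmod_R; apply Rabs_pos_eq; lra).
  assert (B1 := A (RtoC (t + h)) eq_refl). assert (B2 := A' (RtoC (t + h)) eq_refl).
  rewrite Mh in B1, B2.
  assert (L1 := Rmin_l d d'). assert (L2 := Rmin_r d d').
  specialize (B1 ltac:(unfold h; lra)). specialize (B2 ltac:(unfold h; lra)).
  rewrite Eh in B1, B2. set (D := f (RtoC (t + h)) - f t) in *.
  assert (T := Cmod_triangle (D - h * l) (- (D - h * l'))).
  rewrite Cmod_opp in T.
  replace (D - h * l + - (D - h * l')) with (h * (l' - l)) in T by ring.
  rewrite Cmod_mult, Cmod_R, Rabs_pos_eq in T by lra. unfold e in *. nra.
Qed.

Lemma deriv_in_inv (S : C -> Prop) (f : C -> C) (z l : C) :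
  f z <> 0 -> deriv_in S f z l ->
  deriv_in S (fun w => / f w) z (- / (f z * f z) * l).
Proof.
  intros Hz Df.
  apply (deriv_in_comp S anywhere f (fun v => / v)); auto.
  { intros; exact I. }
  set (v := f z) in *. assert (P := proj1 (Cmod_gt_0 _) Hz).
  apply is_derive_C_anywhere.
  apply is_derive_C_deriv_in with (S := opendisc v (Cmod v)) (r := Cmod v); auto.
  exists (fun w => - (1) * / (w * v)). split.
  - replace (- / (v * v)) with (- (1) * / (v * v)) by (field; auto).
    apply tends_mult; [apply tends_const|].
    apply tends_inv; [now apply Cmult_neq_0|].
    apply tends_mult; [apply tends_id|apply tends_const].
  - intros w Hw. field. split; [exact Hz|]. intros ->.
    unfold opendisc in Hw. replace (0 - v) with (- v) in Hw by ring.
    rewrite Cmod_opp in Hw. lra.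
Qed.

(** * The complex exponential and logarithm *)

Lemma Cexp_plus (z w : C) : Cexp (z + w) = Cexp z * Cexp w.
Proof.
  destruct z as [a b], w as [a' b']. unfold Cexp, Cmult; simpl.
  rewrite exp_plus, cos_plus, sin_plus. f_equal; ring.
Qed.

Lemma Cexp_0 : Cexp 0 = 1.
Proof.
  unfold Cexp; simpl. rewrite exp_0, cos_0, sin_0. unfold RtoC; f_equal; ring.
Qed.

Lemma Cexp_neq_0 (z : C) : Cexp z <> 0.
Proof.
  intro H. apply C1_nz. rewrite <- Cexp_0.
  replace (RtoC 0) with (z + - z) by ring. rewrite Cexp_plus, H. ring.
Qed.

Lemma Cexp_opp (z : C) : Cexp (- z) = / Cexp z.
Proof.
  assert (H := Cexp_plus z (- z)). rewrite Cplus_opp_r, Cexp_0 in H.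
  assert (N := Cexp_neq_0 z).
  replace (Cexp (- z)) with (Cexp z * Cexp (- z) / Cexp z) by (field; auto).
  rewrite <- H. field; auto.
Qed.

(** For isochrony, [z] is the growth of a logarithm over one period and [k] the
    numerator of Delta. *)
Lemma Cexp_Zmult (k : Z) (z : C) : Cexp z = 1 -> Cexp (IZR k * z) = 1.
Proof.
  intros H.
  assert (P : forall n : nat, Cexp (INR n * z) = 1).
  { induction n as [|n IH].
    - simpl. rewrite Cmult_0_l. apply Cexp_0.
    - rewrite S_INR, RtoC_plus.
      replace ((INR n + 1) * z) with (INR n * z + z) by ring.
      rewrite Cexp_plus, IH, H. ring. }
  destruct (Z_le_gt_dec 0 k) as [Hk|Hk].
  - rewrite <- (Z2Nat.id k) by exact Hk. rewrite <- INR_IZR_INZ. apply P.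
  - replace k with (- Z.of_nat (Z.to_nat (- k)))%Z by lia.
    rewrite opp_IZR, <- INR_IZR_INZ, RtoC_opp.
    set (n := Z.to_nat (- k)).
    replace (- INR n * z) with (- (INR n * z)) by ring.
    rewrite Cexp_opp, P. field.
Qed.

Lemma slope_at_0 (f : R -> R) (l : R) :
  f 0%R = 0%R -> derivable_pt_lim f 0 l -> forall eps, (0 < eps)%R ->
  exists delta, (0 < delta)%R /\
    forall h, (Rabs h < delta)%R -> (Rabs (f h - l * h) <= eps * Rabs h)%R.
Proof.
  intros H0 H eps Heps. destruct (H eps Heps) as [d Hd].
  exists d; split; [apply cond_pos|]. intros h Hh.
  destruct (Req_dec h 0) as [->|N].
  - rewrite H0, Rmult_0_r, Rminus_0_r, Rabs_R0. lra.
  - specialize (Hd h N Hh). rewrite Rplus_0_l, H0, Rminus_0_r in Hd.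
    replace (f h - l * h)%R with ((f h / h - l) * h)%R by (field; auto).
    rewrite Rabs_mult. apply Rmult_le_compat_r; [apply Rabs_pos|lra].
Qed.

Lemma Cmod_le_components (z : C) : (Cmod z <= Rabs (Re z) + Rabs (Im z))%R.
Proof.
  destruct z as [u v].
  replace (u, v) with (RtoC u + Ci * v)
    by (unfold RtoC, Ci, Cplus, Cmult; simpl; f_equal; ring).
  eapply Rle_trans; [apply Cmod_triangle|].
  rewrite Cmod_mult, !Cmod_R. right. simpl.
  replace (Cmod Ci) with 1%R.
  - f_equal; [|rewrite Rmult_1_l]; f_equal; ring.
  - unfold Cmod, Ci; simpl. replace (0 * (0 * 1) + 1 * (1 * 1))%R with 1%R by ring.
    now rewrite sqrt_1.
Qed.

Lemma im_le_Cmod (z : C) : (Rabs (Im z) <= Cmod z)%R.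
Proof. eapply Rle_trans; [apply Rmax_r|apply Rmax_Cmod]. Qed.

(** [exp (a + i b) - 1 - (a + i b)] has real part
    [exp a (cos b - 1) + (exp a - 1 - a)] and imaginary part
    [exp a (sin b - b) + (exp a - 1) b]; each term is small with respect to
    [|a| + |b|] by the real derivatives of exp, cos and sin at 0. *)
Lemma Cexp_at_0 (eps : R) : (0 < eps)%R -> exists delta : R, (0 < delta)%R /\
  forall h : C, (Cmod h < delta)%R ->
    (Cmod (Cexp h - 1 - h) <= eps * Cmod h)%R.
Proof.
  intros Heps. set (e := Rmin 1 (eps / 8)).
  assert (He : (0 < e)%R) by (apply Rmin_glb_lt; lra).
  assert (He1 : (e <= 1)%R) by apply Rmin_l.
  assert (He2 : (8 * e <= eps)%R) by (assert (T := Rmin_r 1 (eps / 8)); fold e in T; lra).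
  assert (Dexp : derivable_pt_lim (fun x => exp x - 1)%R 0 1).
  { apply is_derive_Reals. auto_derive; [trivial|]. rewrite exp_0; ring. }
  assert (Dcos : derivable_pt_lim (fun x => cos x - 1)%R 0 0).
  { apply is_derive_Reals. auto_derive; [trivial|]. rewrite sin_0; ring. }
  assert (Dsin : derivable_pt_lim sin 0 1).
  { apply is_derive_Reals. auto_derive; [trivial|]. rewrite cos_0; ring. }
  destruct (slope_at_0 (fun x => exp x - 1)%R 1 ltac:(cbv beta; rewrite exp_0; ring) Dexp e He) as [d1 [Hd1 H1]].
  destruct (slope_at_0 (fun x => cos x - 1)%R 0 ltac:(cbv beta; rewrite cos_0; ring) Dcos e He) as [d2 [Hd2 H2]].
  destruct (slope_at_0 _ _ sin_0 Dsin e He) as [d3 [Hd3 H3]].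
  exists (Rmin (Rmin d1 d2) (Rmin d3 (e / 2))). split.
  { repeat apply Rmin_glb_lt; lra. }
  intros [a b] Hh.
  assert (Ba := re_le_Cmod (a, b)). assert (Bb := im_le_Cmod (a, b)).
  simpl in Ba, Bb. set (m := Cmod (a, b)) in *.
  assert (L1 := Rmin_l (Rmin d1 d2) (Rmin d3 (e / 2))).
  assert (L2 := Rmin_r (Rmin d1 d2) (Rmin d3 (e / 2))).
  assert (L3 := Rmin_l d1 d2). assert (L4 := Rmin_r d1 d2).
  assert (L5 := Rmin_l d3 (e / 2)). assert (L6 := Rmin_r d3 (e / 2)).
  specialize (H1 a ltac:(lra)). specialize (H2 b ltac:(lra)).
  specialize (H3 b ltac:(lra)).
  rewrite Rmult_1_l in H1, H3. rewrite Rmult_0_l, Rminus_0_r in H2.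
  assert (Pa := Rabs_pos a). assert (Pb := Rabs_pos b).
  assert (E1 : (Rabs (exp a - 1) <= e)%R).
  { replace (exp a - 1)%R with ((exp a - 1 - a) + a)%R by ring.
    eapply Rle_trans; [apply Rabs_triang|]. nra. }
  assert (E2 : (Rabs (exp a) <= 2)%R).
  { replace (exp a)%R with ((exp a - 1) + 1)%R by ring.
    eapply Rle_trans; [apply Rabs_triang|]. rewrite Rabs_R1. lra. }
  eapply Rle_trans; [apply Cmod_le_components|]. simpl.
  replace (exp a * cos b + - (1) + - a)%R
    with (exp a * (cos b - 1) + (exp a - 1 - a))%R by ring.
  replace (exp a * sin b + - 0 + - b)%R
    with (exp a * (sin b - b) + (exp a - 1) * b)%R by ring.
  assert (T1 := Rabs_triang (exp a * (cos b - 1)) (exp a - 1 - a)).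
  assert (T2 := Rabs_triang (exp a * (sin b - b)) ((exp a - 1) * b)).
  rewrite Rabs_mult in T1.
  rewrite (Rabs_mult (exp a) (sin b - b)), (Rabs_mult (exp a - 1) b) in T2.
  assert (P2 := Rabs_pos (cos b - 1)). assert (P3 := Rabs_pos (sin b - b)).
  assert (P4 := Rabs_pos (exp a - 1)). assert (P5 := Rabs_pos (exp a)).
  assert (Q1 : (Rabs (exp a) * Rabs (cos b - 1) <= 2 * (e * m))%R).
  { apply Rmult_le_compat; auto. nra. }
  assert (Q2 : (Rabs (exp a) * Rabs (sin b - b) <= 2 * (e * m))%R).
  { apply Rmult_le_compat; auto. nra. }
  assert (Q3 : (Rabs (exp a - 1) * Rabs b <= e * m)%R).
  { apply Rmult_le_compat; auto. }
  assert (Q4 : (e * Rabs a <= e * m)%R) by (apply Rmult_le_compat_l; lra).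
  assert (Q5 : (8 * e * m <= eps * m)%R) by (apply Rmult_le_compat_r; lra).
  assert (Q6 : (0 <= e * m)%R) by (apply Rmult_le_pos; lra).
  lra.
Qed.

Lemma deriv_in_Cexp (S : C -> Prop) (z : C) : deriv_in S Cexp z (Cexp z).
Proof.
  rewrite deriv_in_eps. intros eps Heps.
  assert (P := proj1 (Cmod_gt_0 _) (Cexp_neq_0 z)).
  destruct (Cexp_at_0 (eps / Cmod (Cexp z))) as [d [Hd H]].
  { now apply Rdiv_lt_0_compat. }
  exists d; split; [exact Hd|]. intros w _ Hw.
  replace (Cexp w) with (Cexp z * Cexp (w - z))
    by (rewrite <- Cexp_plus; f_equal; ring).
  replace (Cexp z * Cexp (w - z) - Cexp z - (w - z) * Cexp z)
    with (Cexp z * (Cexp (w - z) - 1 - (w - z))) by ring.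
  rewrite Cmod_mult. specialize (H (w - z) Hw).
  apply Rle_trans with (Cmod (Cexp z) * (eps / Cmod (Cexp z) * Cmod (w - z)))%R.
  - apply Rmult_le_compat_l; lra.
  - right. field. lra.
Qed.

Lemma deriv_in_Cexp_comp (S : C -> Prop) (f : C -> C) (z l : C) :
  deriv_in S f z l -> deriv_in S (fun w => Cexp (f w)) z (Cexp (f z) * l).
Proof.
  intros H. apply deriv_in_comp with (S' := anywhere); auto.
  - intros; exact I.
  - apply deriv_in_Cexp.
Qed.

(** The principal logarithm, on the right half plane only: there the argument is
    an arc tangent. *)
Definition Log (w : C) : C := (ln (Cmod w), atan (Im w / Re w)).

Lemma Cexp_Log (w : C) : (0 < Re w)%R -> Cexp (Log w) = w.
Proof.
  intros H. destruct w as [u v]; simpl in H.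
  assert (P : (0 < Cmod (u, v))%R).
  { apply Cmod_gt_0. intro E. injection E. lra. }
  unfold Cexp, Log; simpl. rewrite exp_ln by exact P.
  rewrite cos_atan, sin_atan.
  assert (E : sqrt (1 + (v / u)²) = (Cmod (u, v) / u)%R).
  { unfold Cmod; simpl.
    replace (1 + (v / u)²)%R with ((u * (u * 1) + v * (v * 1)) / (u * u))%R
      by (unfold Rsqr; field; lra).
    rewrite sqrt_div_alt by nra. f_equal. rewrite sqrt_square; lra. }
  rewrite E. f_equal; field; lra.
Qed.

Lemma Cmod_Cexp (z : C) : Cmod (Cexp z) = exp (Re z).
Proof.
  unfold Cmod, Cexp; simpl.
  replace (_ + _)%R with ((exp (Re z) * exp (Re z)) * ((sin (Im z))² + (cos (Im z))²))%R
    by (unfold Rsqr; ring).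
  rewrite sin2_cos2, Rmult_1_r. apply sqrt_square. left; apply exp_pos.
Qed.

Lemma Log_Cexp (z : C) : (Rabs (Im z) < PI / 2)%R -> Log (Cexp z) = z.
Proof.
  intros H. destruct (Rabs_def2 _ _ H) as [H1 H2].
  unfold Log. rewrite Cmod_Cexp, ln_exp.
  replace (Im (Cexp z) / Re (Cexp z))%R with (tan (Im z)).
  - rewrite atan_tan by lra. now destruct z.
  - unfold Cexp, tan; simpl. assert (0 < cos (Im z))%R by (apply cos_gt_0; lra).
    assert (P := exp_pos (Re z)). field. lra.
Qed.

Lemma tends_Log_1 (S : C -> Prop) : tends S Log 1 0.
Proof.
  intros eps Heps.
  assert (Cln : continuity_pt ln 1).
  { apply derivable_continuous_pt. exists (/ 1)%R. apply derivable_pt_lim_ln. lra. }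
  assert (Cat : continuity_pt atan 0).
  { apply derivable_continuous_pt. exists (/ (1 + 0 ^ 2))%R.
    apply derivable_pt_lim_atan. }
  destruct (proj1 (continuity_pt_locally _ _) Cln (mkposreal (eps / 2) ltac:(lra)))
    as [d1 H1].
  destruct (proj1 (continuity_pt_locally _ _) Cat (mkposreal (eps / 2) ltac:(lra)))
    as [d2 H2].
  assert (P1 := cond_pos d1). assert (P2 := cond_pos d2).
  exists (Rmin (1 / 2) (Rmin d1 (d2 / 2))). split.
  { repeat apply Rmin_glb_lt; lra. }
  intros w _ Hw.
  assert (L1 := Rmin_l (1 / 2) (Rmin d1 (d2 / 2))).
  assert (L2 := Rmin_r (1 / 2) (Rmin d1 (d2 / 2))).
  assert (L3 := Rmin_l d1 (d2 / 2)). assert (L4 := Rmin_r d1 (d2 / 2)).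
  assert (Ba := re_le_Cmod (w - 1)). assert (Bb := im_le_Cmod (w - 1)).
  assert (T1 := Cmod_triangle (w - 1) 1).
  replace (w - 1 + 1) with w in T1 by ring.
  assert (T2 := Cmod_triangle w (- (w - 1))).
  replace (w + - (w - 1)) with (RtoC 1) in T2 by ring.
  rewrite Cmod_opp in T2. rewrite Cmod_1 in T1, T2.
  set (m := Cmod (w - 1)) in *. clearbody m. destruct w as [u v]. simpl in Ba, Bb.
  assert (Hu : (1 / 2 < u)%R) by (destruct (Rabs_def2 (u + - (1)) (1/2)); lra).
  rewrite Ropp_0, Rplus_0_r in Bb.
  assert (Q1 : ball 1%R d1 (Cmod (u, v))).
  { change (Rabs (Cmod (u, v) - 1) < d1)%R. apply Rabs_def1; lra. }
  assert (Q2 : ball 0%R d2 (v / u)%R).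
  { change (Rabs (v / u - 0) < d2)%R. rewrite Rminus_0_r. unfold Rdiv.
    rewrite Rabs_mult, (Rabs_pos_eq (/ u)) by (left; apply Rinv_0_lt_compat; lra).
    apply Rmult_lt_reg_r with u; [lra|].
    rewrite Rmult_assoc, Rinv_l, Rmult_1_r by lra. nra. }
  apply H1 in Q1. apply H2 in Q2. simpl in Q1, Q2.
  rewrite ln_1 in Q1. rewrite atan_0 in Q2.
  eapply Rle_lt_trans; [apply Cmod_le_components|].
  unfold Log; simpl. unfold Rminus in Q1, Q2. lra.
Qed.

(** * The change of variables *)

Lemma deriv_in_ttilde (S : C -> Prop) (eta t : C) :
  eta <> 0 -> deriv_in S (ttilde eta) t (Cexp (eta * t)).
Proof.
  intros He.
  apply deriv_in_ext with (f := fun w => / eta * (Cexp (eta * w) + - (1)))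
    (l := / eta * (Cexp (eta * t) * (eta * 1) + 0)).
  - intros w _. unfold ttilde. field. exact He.
  - unfold ttilde. field. exact He.
  - field. exact He.
  - apply deriv_in_scal, deriv_in_plus; [|apply deriv_in_const].
    apply (deriv_in_Cexp_comp S (fun w => eta * w)), deriv_in_scal, deriv_in_id.
Qed.

(** The branch near [ttilde eta t0] of the inverse of [ttilde eta] with value [t0]
    there.  Dividing by [Cexp (eta * t0)] moves the argument of the logarithm
    close to 1, where the principal branch is regular. *)
Definition ttilde_inv (eta t0 y : C) : C :=
  t0 + Log ((1 + eta * y) / Cexp (eta * t0)) / eta.

Lemma ttilde_ratio (eta t0 t : C) : eta <> 0 ->
  (1 + eta * ttilde eta t) / Cexp (eta * t0) = Cexp (eta * (t - t0)).
Proof.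
  intros He. assert (N := Cexp_neq_0 (eta * t0)).
  replace (eta * (t - t0)) with (eta * t + - (eta * t0)) by ring.
  rewrite Cexp_plus, Cexp_opp. unfold ttilde. field. auto.
Qed.

Lemma ttilde_inv_left (eta t0 t : C) :
  eta <> 0 -> (Cmod (eta * (t - t0)) < PI / 2)%R ->
  ttilde_inv eta t0 (ttilde eta t) = t.
Proof.
  intros He Ht. unfold ttilde_inv. rewrite ttilde_ratio by exact He.
  rewrite Log_Cexp.
  - field. exact He.
  - eapply Rle_lt_trans; [apply im_le_Cmod|exact Ht].
Qed.

Lemma ttilde_inv_right (eta t0 y : C) :
  eta <> 0 -> (0 < Re ((1 + eta * y) / Cexp (eta * t0)))%R ->
  ttilde eta (ttilde_inv eta t0 y) = y.
Proof.
  intros He Hy. assert (N := Cexp_neq_0 (eta * t0)).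
  unfold ttilde, ttilde_inv.
  set (L := Log ((1 + eta * y) / Cexp (eta * t0))).
  replace (eta * (t0 + L / eta)) with (eta * t0 + L) by (field; auto).
  rewrite Cexp_plus. unfold L. rewrite Cexp_Log by exact Hy. field. auto.
Qed.

Lemma ttilde_inv_local (eta t0 : C) : eta <> 0 ->
  exists r : R, (0 < r)%R /\
    (forall y, opendisc (ttilde eta t0) r y ->
       ttilde eta (ttilde_inv eta t0 y) = y) /\
    deriv_in (opendisc (ttilde eta t0) r) (ttilde_inv eta t0) (ttilde eta t0)
      (/ Cexp (eta * t0)).
Proof.
  intros He. set (y0 := ttilde eta t0).
  assert (N := Cexp_neq_0 (eta * t0)).
  assert (G0 : ttilde_inv eta t0 y0 = t0).
  { unfold y0. rewrite ttilde_inv_left; auto.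
    replace (eta * (t0 - t0)) with (RtoC 0) by ring. rewrite Cmod_0.
    assert (T := PI_RGT_0). lra. }
  assert (T : forall S, tends S (fun y => (1 + eta * y) / Cexp (eta * t0)) y0 1).
  { intros S.
    assert (E1 : (1 + eta * y0) / Cexp (eta * t0) = 1).
    { unfold y0. rewrite ttilde_ratio by exact He.
      replace (eta * (t0 - t0)) with (RtoC 0) by ring. apply Cexp_0. }
    refine (eq_ind _ (tends S _ y0) _ _ E1). apply tends_mult; [|apply tends_const].
    apply tends_plus; [apply tends_const|].
    apply tends_mult; [apply tends_const|apply tends_id]. }
  destruct (T anywhere 1%R ltac:(lra)) as [r [Hr H]].
  assert (P : forall y, opendisc y0 r y ->
            (0 < Re ((1 + eta * y) / Cexp (eta * t0)))%R).
  { intros y Hy. specialize (H y I Hy).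
    assert (B := re_le_Cmod ((1 + eta * y) / Cexp (eta * t0) - 1)).
    set (u := (1 + eta * y) / Cexp (eta * t0)) in *.
    replace (Re (u - 1)) with (Re u - 1)%R in B by reflexivity.
    destruct (Rabs_def2 (Re u - 1) 1); lra. }
  assert (Q : forall y, opendisc y0 r y ->
            ttilde eta (ttilde_inv eta t0 y) = y).
  { intros y Hy. apply ttilde_inv_right; auto. }
  exists r. repeat split; auto.
  apply deriv_in_inverse with (S := anywhere) (f := ttilde eta); auto.
  - intros; exact I.
  - now rewrite G0.
  - rewrite G0. unfold ttilde_inv.
    refine (eq_ind (t0 + 0 * / eta) (tends _ _ y0) _ t0 ltac:(field; exact He)).
    apply tends_plus; [apply tends_const|].
    apply tends_mult; [|apply tends_const].
    apply tends_comp with (S' := anywhere) (l := RtoC 1).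
    + intros; exact I.
    + apply T.
    + apply tends_Log_1.
  - rewrite G0. now apply deriv_in_ttilde.
Qed.

(** The coefficients [dcoef] expand the quadratic part about [zbar], where only its
    homogeneous part and the linear term [eta (z - zbar)] remain. *)
Lemma rhsZ_change (c : I2 -> I3 -> C) (zbar : I2 -> C) (eta : C)
    (x : I2 -> C) (e : C) (n : I2) :
  rhsZ c zbar eta (fun m => e * x m + zbar m) n = eta * e * x n + e * (rhsS c x n * e).
Proof. unfold rhsZ, rhsS, dcoef. destruct n; ring. Qed.

Lemma deriv_in_change (S S' : C -> Prop) (zbar : I2 -> C) (eta : C)
    (x : I2 -> C -> C) (n : I2) (t l : C) :
  eta <> 0 -> (forall w, S w -> S' (ttilde eta w)) ->
  deriv_in S' (x n) (ttilde eta t) l ->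
  deriv_in S (change zbar eta x n) t
    (eta * Cexp (eta * t) * x n (ttilde eta t)
     + Cexp (eta * t) * (l * Cexp (eta * t))).
Proof.
  intros He HS Hx. set (E := Cexp (eta * t)).
  apply deriv_in_ext
    with (f := fun w => Cexp (eta * w) * x n (ttilde eta w) + zbar n)
         (l := E * (eta * 1) * x n (ttilde eta t) + E * (l * E) + 0); auto.
  { ring. }
  apply deriv_in_plus; [|apply deriv_in_const].
  apply (deriv_in_mult S (fun w => Cexp (eta * w)) (fun w => x n (ttilde eta w))).
  - apply (deriv_in_Cexp_comp S (fun w => eta * w)), deriv_in_scal, deriv_in_id.
  - apply deriv_in_comp with (S' := S'); auto. now apply deriv_in_ttilde.
Qed.

Lemma change_solves (c : I2 -> I3 -> C) (zbar : I2 -> C) (eta : C)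
    (x : I2 -> C -> C) (t : C) :
  eta <> 0 -> solves_at (rhsS c) x (ttilde eta t) ->
  solves_at (rhsZ c zbar eta) (change zbar eta x) t.
Proof.
  intros He Hx n. apply is_derive_C_anywhere.
  unfold change at 2. rewrite rhsZ_change with (x := fun m => x m (ttilde eta t)).
  apply deriv_in_change with (S' := anywhere); auto.
  apply is_derive_C_anywhere, Hx.
Qed.

(** With [g] the local inverse of [ttilde eta], [x n] is
    [(change zbar eta x n (g y) - zbar n) exp (- eta (g y))] near [ttilde eta t], so
    that it is differentiable with the derivative given by the rules. *)
Lemma change_solves_inv (c : I2 -> I3 -> C) (zbar : I2 -> C) (eta : C)
    (x : I2 -> C -> C) (t : C) :
  eta <> 0 -> solves_at (rhsZ c zbar eta) (change zbar eta x) t ->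
  solves_at (rhsS c) x (ttilde eta t).
Proof.
  intros He Hz n.
  destruct (ttilde_inv_local eta t He) as [r [Hr [Hg Dg]]].
  set (g := ttilde_inv eta t) in *. set (y := ttilde eta t) in *.
  assert (G0 : g y = t).
  { unfold g, y. rewrite ttilde_inv_left; auto.
    replace (eta * (t - t)) with (RtoC 0) by ring. rewrite Cmod_0.
    assert (T := PI_RGT_0). lra. }
  apply is_derive_C_deriv_in with (S := opendisc y r) (r := r); auto.
  assert (Dz := proj1 (is_derive_C_anywhere _ _ _) (Hz n)).
  unfold change at 2 in Dz. fold y in Dz.
  rewrite rhsZ_change with (x := fun m => x m y) in Dz.
  set (E := Cexp (eta * t)) in *. assert (N : E <> 0) by apply Cexp_neq_0.
  set (F := rhsS c (fun m => x m y) n) in *.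
  rewrite <- G0 in Dz at 1.
  assert (D1 := deriv_in_comp _ _ _ _ _ _ _ (fun w _ => I) Dg Dz).
  assert (D2 : deriv_in (opendisc y r) (fun w => Cexp (- eta * g w)) y
                 (Cexp (- eta * g y) * (- eta * / E))).
  { apply (deriv_in_Cexp_comp (opendisc y r) (fun w => - eta * g w)).
    now apply deriv_in_scal. }
  assert (D3 := deriv_in_plus _ _ _ _ _ _ D1 (deriv_in_const _ (- zbar n) y)).
  assert (D4 := deriv_in_mult _ _ _ _ _ _ D3 D2).
  assert (Ey : Cexp (- eta * g y) = / E).
  { rewrite G0. unfold E. rewrite <- Cexp_opp. f_equal. ring. }
  assert (Q : forall w, ttilde eta (g w) = w ->
    (change zbar eta x n (g w) + - zbar n) * Cexp (- eta * g w) = x n w).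
  { intros w Hw. unfold change. rewrite Hw.
    replace (- eta * g w) with (- (eta * g w)) by ring. rewrite Cexp_opp.
    field. apply Cexp_neq_0. }
  eapply deriv_in_ext; [| | |exact D4].
  - intros w Sw. exact (Q w (Hg w Sw)).
  - exact (Q y (f_equal (ttilde eta) G0)).
  - cbv beta. rewrite Ey. unfold change. rewrite G0. fold E y. field. exact N.
Qed.

(** On a disc of radius [1 / |eta|] the map [ttilde eta] is injective, because
    [1 < PI / 2]; so [x] can be read off from [z]. *)
Lemma change_locally_onto (zbar : I2 -> C) (eta : C) (z : I2 -> C -> C) (t0 : C) :
  eta <> 0 ->
  exists (x : I2 -> C -> C) (r : R), (0 < r)%R /\
    forall n t, opendisc t0 r t -> z n t = change zbar eta x n t.
Proof.
  intros He. assert (P := proj1 (Cmod_gt_0 _) He).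
  exists (fun n y => (z n (ttilde_inv eta t0 y) - zbar n)
                     / Cexp (eta * ttilde_inv eta t0 y)), (/ Cmod eta)%R.
  split; [now apply Rinv_0_lt_compat|]. intros n t Ht.
  unfold change. rewrite ttilde_inv_left; auto.
  - field. apply Cexp_neq_0.
  - rewrite Cmod_mult. apply Rlt_trans with (Cmod eta * / Cmod eta)%R.
    + now apply Rmult_lt_compat_l.
    + rewrite Rinv_r by lra. assert (T := PI2_1). lra.
Qed.

(** Along the real axis the chain rule determines [eta E x + E^2 x'], hence [x'],
    since derivatives along the axis are unique. *)
Lemma change_solves_real (c : I2 -> I3 -> C) (zbar : I2 -> C) (eta : C)
    (x : I2 -> C -> C) (t : R) :
  eta <> 0 ->
  (forall n, ex_derive (K := C_AbsRing) (V := C_NormedModule)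
               (x n) (ttilde eta t)) ->
  (solves_at (rhsS c) x (ttilde eta t) <->
   solves_at_real (rhsZ c zbar eta)
     (fun n (s : R) => change zbar eta x n s) t).
Proof.
  intros He Hx. split.
  - intros H n. apply is_derive_R_on_reals.
    apply deriv_in_sub with (S' := anywhere); [intros; exact I|].
    apply is_derive_C_anywhere. now apply change_solves.
  - intros H n. destruct (Hx n) as [l Hl].
    assert (Dz := proj1 (is_derive_R_on_reals _ _ _) (H n)).
    unfold change at 2 in Dz.
    rewrite rhsZ_change with (x := fun m => x m (ttilde eta t)) in Dz.
    assert (Dc := deriv_in_change on_reals anywhere zbar eta x n t l He
                    (fun _ _ => I) (proj1 (is_derive_C_anywhere _ _ _) Hl)).
    assert (U := deriv_in_reals_unique _ _ _ _ Dz Dc).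
    assert (N := Cexp_neq_0 (eta * t)). set (E := Cexp (eta * t)) in *.
    set (F := rhsS c (fun m => x m (ttilde eta t)) n) in *.
    assert (EF : F = l).
    { replace F with ((eta * E * x n (ttilde eta t) + E * (F * E)
                       - eta * E * x n (ttilde eta t)) / (E * E)) by (field; auto).
      rewrite U. field; auto. }
    now rewrite EF.
Qed.

(** * Elementary formulas under substitution *)

Lemma ball_C_Cmod (z w : C) (eps : R) :
  (Cmod (w - z) < eps)%R -> ball (M := C_UniformSpace) z eps w.
Proof.
  intros H. assert (Ba := re_le_Cmod (w - z)). assert (Bb := im_le_Cmod (w - z)).
  split.
  - change (Rabs (Re (w - z)) < eps)%R. lra.
  - change (Rabs (Im (w - z)) < eps)%R. lra.
Qed.

Lemma Cmod_ball_C (z w : C) (eps : R) :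
  ball (M := C_UniformSpace) z (eps / 2) w -> (Cmod (w - z) < eps)%R.
Proof.
  intros [H1 H2].
  change (Rabs (Re (w - z)) < eps / 2)%R in H1.
  change (Rabs (Im (w - z)) < eps / 2)%R in H2.
  eapply Rle_lt_trans; [apply Cmod_le_components|]. lra.
Qed.

Lemma tends_continuous (f : C -> C) (z : C) :
  tends anywhere f z (f z) ->
  continuous (T := C_UniformSpace) (U := C_UniformSpace) f z.
Proof.
  intros H. apply filterlim_locally. intros eps.
  destruct (H eps (cond_pos eps)) as [d [Hd Hd']].
  exists (mkposreal (d / 2) ltac:(lra)). intros w Hw.
  apply ball_C_Cmod, Hd'; [exact I|]. now apply Cmod_ball_C.
Qed.

Lemma opendisc_open (z0 : C) (r : R) :
  open (T := C_UniformSpace) (opendisc z0 r).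
Proof.
  intros z Hz. unfold opendisc in Hz.
  exists (mkposreal ((r - Cmod (z - z0)) / 2) ltac:(lra)). intros w Hw.
  apply Cmod_ball_C in Hw. unfold opendisc.
  replace (w - z0) with ((w - z) + (z - z0)) by ring.
  eapply Rle_lt_trans; [apply Cmod_triangle|]. lra.
Qed.

Lemma denotes_ext {X : Type} (U : C -> Prop) (env : X -> C -> C)
    (e : formula X) (f g : C -> C) :
  open (T := C_UniformSpace) U -> (forall t, U t -> f t = g t) ->
  denotes U env e f -> denotes U env e g.
Proof.
  intros HU Hfg.
  assert (Hc : (forall t, U t -> continuous f t) ->
               (forall t, U t -> continuous g t)).
  { intros H t Ut. apply continuous_ext_loc with (g := f); [|auto].
    apply filter_imp with (2 := HU t Ut). exact Hfg. }
  destruct e; simpl.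
  - intros H t Ut. rewrite <- Hfg; auto.
  - intros H t Ut. rewrite <- Hfg; auto.
  - intros (g1 & g2 & H1 & H2 & H). exists g1, g2. repeat split; auto.
    intros t Ut. rewrite <- Hfg; auto.
  - intros (g1 & g2 & H1 & H2 & H). exists g1, g2. repeat split; auto.
    intros t Ut. rewrite <- Hfg; auto.
  - intros (g1 & H1 & H). exists g1. split; auto.
    intros t Ut. rewrite <- Hfg; auto.
  - intros (g1 & H1 & H). exists g1. split; auto.
    intros t Ut. rewrite <- Hfg; auto.
  - intros (g1 & H1 & H2 & H). exists g1. repeat split; auto.
    intros t Ut. rewrite <- Hfg; auto.
  - intros (g1 & H1 & H2 & H). exists g1. repeat split; auto.
    intros t Ut. rewrite <- Hfg; auto.
Qed.

Fixpoint fsubst {X Y : Type} (s : X -> formula Y) (e : formula X) : formula Y :=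
  match e with
  | FVar v => s v
  | FCst k => FCst _ k
  | FAdd e1 e2 => FAdd _ (fsubst s e1) (fsubst s e2)
  | FMul e1 e2 => FMul _ (fsubst s e1) (fsubst s e2)
  | FInv e1 => FInv _ (fsubst s e1)
  | FExp e1 => FExp _ (fsubst s e1)
  | FLog e1 => FLog _ (fsubst s e1)
  | FRoot d a => FRoot _ d (fun i => fsubst s (a i))
  end.

(** Substituting [phi] for the variable of a branch gives a branch of the
    substituted formula: the two multivalued constructors only require
    continuity, which composition preserves. *)
Lemma denotes_subst {X Y : Type} (U U' : C -> Prop) (phi : C -> C)
    (env : X -> C -> C) (env' : Y -> C -> C) (s : X -> formula Y)
    (e : formula X) (f : C -> C) :
  open (T := C_UniformSpace) U' ->
  (forall t, U' t -> U (phi t)) -> (forall t, U' t -> continuous phi t) ->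
  (forall v, denotes U' env' (s v) (fun t => env v (phi t))) ->
  denotes U env e f -> denotes U' env' (fsubst s e) (fun t => f (phi t)).
Proof.
  intros HU Hphi Cphi Hs. revert f.
  assert (Hc : forall f : C -> C, (forall t, U t -> continuous f t) ->
            forall t, U' t -> continuous (fun t => f (phi t)) t).
  { intros f H t Ut. apply continuous_comp; auto. }
  induction e as [v|k|e1 IH1 e2 IH2|e1 IH1 e2 IH2|e1 IH1|e1 IH1|e1 IH1|d a IH];
    simpl; intros f.
  - intros H. apply denotes_ext with (f := fun t => env v (phi t)); auto.
    intros t Ut. symmetry. auto.
  - auto.
  - intros (g1 & g2 & H1 & H2 & H).
    exists (fun t => g1 (phi t)), (fun t => g2 (phi t)). auto.
  - intros (g1 & g2 & H1 & H2 & H).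
    exists (fun t => g1 (phi t)), (fun t => g2 (phi t)). auto.
  - intros (g1 & H1 & H). exists (fun t => g1 (phi t)). auto.
  - intros (g1 & H1 & H). exists (fun t => g1 (phi t)). auto.
  - intros (g1 & H1 & H2 & H). exists (fun t => g1 (phi t)). auto.
  - intros (g1 & H1 & H2 & H). exists (fun i t => g1 i (phi t)).
    repeat split; auto.
Qed.

Definition ttilde_formula : formula (sol_var parZ) :=
  FMul _ (FAdd _ (FExp _ (FMul _ (FVar _ (VPar _ Zeta)) (FVar _ (VTime _))))
                 (FCst _ (- (1))))
         (FInv _ (FVar _ (VPar _ Zeta))).

Definition subst_SZ (v : sol_var parS) : formula (sol_var parZ) :=
  match v with
  | VTime => ttilde_formula
  | VPar (Sc n l) => FVar _ (VPar _ (Zc n l))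
  | VInit n => FAdd _ (FVar _ (VInit _ n))
                        (FMul _ (FCst _ (- (1))) (FVar _ (VPar _ (Zbar n))))
  end.

Definition formulaZ (F : I2 -> formula (sol_var parS)) (n : I2)
    : formula (sol_var parZ) :=
  FAdd _ (FMul _ (FExp _ (FMul _ (FVar _ (VPar _ Zeta)) (FVar _ (VTime _))))
                 (fsubst subst_SZ (F n)))
         (FVar _ (VPar _ (Zbar n))).

Lemma ttilde_0 (eta : C) : eta <> 0 -> ttilde eta 0 = 0.
Proof.
  intros He. unfold ttilde. rewrite Cmult_0_r, Cexp_0. field. exact He.
Qed.

(** The solution of (Z) with initial value [z0] is the image by [change] of the
    solution of (S) with initial value [z0 - zbar], as [ttilde eta 0 = 0]. *)
Lemma solvable_change (D : (parS -> C) -> (I2 -> C) -> Prop) :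
  solvable familyS D -> solvable familyZ (dataZ D).
Proof.
  intros [F HF]. exists (formulaZ F). intros p z0 [He HD].
  set (eta := p Zeta) in *. set (zbar := fun n => p (Zbar n)).
  set (q := fun s : parS => match s with Sc n l => p (Zc n l) end) in *.
  set (x0 := fun n => z0 n - p (Zbar n)) in *.
  destruct (HF q x0 HD) as (r & x & Hr & Hx0 & Hx & HxF).
  assert (Ct : forall t, tends anywhere (ttilde eta) t (ttilde eta t)).
  { intros t. apply deriv_in_tends with (l := Cexp (eta * t)).
    now apply deriv_in_ttilde. }
  destruct (Ct 0 r Hr) as [r' [Hr' Hin]].
  assert (Hd : forall t, opendisc 0 r' t -> opendisc 0 r (ttilde eta t)).
  { intros t Ht. specialize (Hin t I Ht). rewrite ttilde_0 in Hin; auto. }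
  exists r', (change zbar eta x). split; [exact Hr'|]. split; [|split].
  - intros n. unfold change. rewrite ttilde_0, Cmult_0_r, Cexp_0, Hx0 by exact He.
    unfold x0, zbar. ring.
  - intros t Ht. apply change_solves; [exact He|]. apply Hx, Hd, Ht.
  - intros n.
    exists (fun t => Cexp (eta * t) * x n (ttilde eta t)), (fun _ => zbar n).
    split; [|split; [simpl; auto|auto]].
    exists (fun t => Cexp (eta * t)), (fun t => x n (ttilde eta t)).
    split; [|split; [|auto]].
    + exists (fun t => eta * t). split; [|auto].
      exists (fun _ => eta), (fun t => t). simpl; auto.
    + apply denotes_subst with (U := opendisc 0 r) (env := sol_env q x0); auto.
      * apply opendisc_open.
      * intros t _. apply tends_continuous, Ct.
      * intros [|[m l]|m]; simpl.
        -- exists (fun t => Cexp (eta * t) + - (1)), (fun _ => / eta).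
           split; [|split].
           ++ exists (fun t => Cexp (eta * t)), (fun _ => - (1)).
              split; [|auto]. exists (fun t => eta * t). split; [|auto].
              exists (fun _ => eta), (fun t => t). auto.
           ++ exists (fun _ => eta). split; [auto|]. intros. field. exact He.
           ++ intros t _. reflexivity.
        -- auto.
        -- exists (fun _ => z0 m), (fun _ => - (1) * zbar m).
           split; [auto|]. split.
           ++ exists (fun _ => - (1)), (fun _ => zbar m). auto.
           ++ intros t _. unfold x0, zbar. ring.
Qed.

(** * Linear and Riccati equations in a real time *)

(** Precomposition with [Re] turns a function of a real time into one of a complex
    variable, so that the rules for [deriv_in] apply to it verbatim. *)
Definition rderiv (f : R -> C) (t : R) (l : C) : Prop :=
  deriv_in on_reals (fun w => f (Re w)) t l.

Lemma is_derive_rderiv (f : R -> C) (t : R) (l : C) :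
  is_derive (K := R_AbsRing) (V := C_R_NormedModule) f t l <-> rderiv f t l.
Proof. exact (is_derive_R_on_reals (fun w => f (Re w)) t l). Qed.

Lemma rderiv_eq (f : R -> C) (t : R) (l l' : C) :
  l = l' -> rderiv f t l -> rderiv f t l'.
Proof. now intros ->. Qed.

Lemma rderiv_plus (f g : R -> C) (t : R) (l m : C) :
  rderiv f t l -> rderiv g t m -> rderiv (fun s => f s + g s) t (l + m).
Proof. exact (deriv_in_plus on_reals _ _ t l m). Qed.

Lemma rderiv_mult (f g : R -> C) (t : R) (l m : C) :
  rderiv f t l -> rderiv g t m ->
  rderiv (fun s => f s * g s) t (l * g t + f t * m).
Proof. exact (deriv_in_mult on_reals _ _ t l m). Qed.

Lemma rderiv_const (k : C) (t : R) : rderiv (fun _ => k) t 0.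
Proof. exact (deriv_in_const on_reals k t). Qed.

Lemma rderiv_scal (k : C) (f : R -> C) (t : R) (l : C) :
  rderiv f t l -> rderiv (fun s => k * f s) t (k * l).
Proof. exact (deriv_in_scal on_reals k _ t l). Qed.

Lemma rderiv_inv (f : R -> C) (t : R) (l : C) :
  f t <> 0 -> rderiv f t l -> rderiv (fun s => / f s) t (- / (f t * f t) * l).
Proof. exact (deriv_in_inv on_reals (fun w => f (Re w)) t l). Qed.

Lemma rderiv_Cexp (f : R -> C) (t : R) (l : C) :
  rderiv f t l -> rderiv (fun s => Cexp (f s)) t (Cexp (f t) * l).
Proof. exact (deriv_in_Cexp_comp on_reals _ t l). Qed.

Lemma rderiv_Cexp_lin (k : C) (t : R) :
  rderiv (fun s => Cexp (k * s)) t (k * Cexp (k * t)).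
Proof.
  apply rderiv_eq with (Cexp (k * t) * (k * 1)); [ring|].
  apply rderiv_Cexp, rderiv_scal.
  apply deriv_in_ext with (f := fun w => w) (l := RtoC 1); auto.
  - apply on_reals_RtoC.
  - apply deriv_in_id.
Qed.

Lemma rderiv_shift (f : R -> C) (h t : R) (l : C) :
  rderiv f (t + h)%R l -> rderiv (fun s => f (s + h)%R) t l.
Proof.
  intros H. rewrite <- (Cmult_1_r l).
  apply (deriv_in_comp on_reals on_reals (fun w => w + h) (fun w => f (Re w))).
  - intros [u v] Sw. unfold on_reals in *. simpl in *. rewrite Sw. ring.
  - rewrite <- (Cplus_0_r 1).
    apply deriv_in_plus; [apply deriv_in_id|apply deriv_in_const].
  - rewrite <- RtoC_plus. exact H.
Qed.

Definition convex (I : R -> Prop) : Prop :=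
  forall a b s : R, I a -> I b -> (a <= s <= b)%R -> I s.

Lemma rderiv_0_const (I : R -> Prop) (f : R -> C) (a b : R) :
  convex I -> (forall s, I s -> rderiv f s 0) -> I a -> I b -> f a = f b.
Proof.
  intros HI Hf.
  assert (P : forall a b, (a < b)%R -> I a -> I b -> f a = f b).
  { clear a b. intros a b Hab Ia Ib.
    apply (eq_is_derive (V := C_R_NormedModule)) with (2 := Hab).
    intros s Hs. apply is_derive_rderiv, Hf. now apply (HI a b). }
  intros Ia Ib. destruct (Rtotal_order a b) as [H|[->|H]]; auto.
  symmetry. auto.
Qed.

Lemma rderiv_RtoC (u : R -> R) (t a : R) :
  is_derive u t a -> rderiv (fun s => RtoC (u s)) t a.
Proof.
  intros H. apply is_derive_Reals in H.
  unfold rderiv. rewrite deriv_in_eps. intros eps Heps.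
  destruct (slope_at_0 (fun h => u (t + h) - u t)%R a) with (eps := eps)
    as [d [Hd Hd']]; auto.
  - rewrite Rplus_0_r. ring.
  - intros e He. destruct (H e He) as [d Hd]. exists d. intros h Hh Hh'.
    specialize (Hd h Hh Hh'). rewrite Rplus_0_l, Rplus_0_r.
    now replace (u (t + h) - u t - (u t - u t))%R with (u (t + h) - u t)%R by ring.
  - exists d; split; [exact Hd|]. intros w Sw.
    rewrite (on_reals_RtoC w Sw). set (s := Re w). simpl.
    rewrite <- !RtoC_minus, <- RtoC_mult, <- RtoC_minus, !Cmod_R. intros Hs.
    specialize (Hd' (s - t)%R Hs).
    replace (t + (s - t))%R with s in Hd' by ring.
    now rewrite (Rmult_comm (s - t) a).
Qed.

Lemma rderiv_components_continuous (f : R -> C) (t : R) (l : C) :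
  rderiv f t l -> continuous (fun s => Re (f s)) t /\ continuous (fun s => Im (f s)) t.
Proof.
  intros H. apply deriv_in_tends in H.
  split; apply filterlim_locally; intros eps;
    destruct (H eps (cond_pos eps)) as [d [Hd Hd']];
    exists (mkposreal d Hd); intros s Hs; specialize (Hd' (RtoC s) eq_refl);
    rewrite RtoC_minus_Cmod in Hd'; specialize (Hd' Hs);
    eapply Rle_lt_trans; try exact Hd'; simpl.
  - exact (re_le_Cmod (f s - f t)).
  - exact (im_le_Cmod (f s - f t)).
Qed.

Lemma is_derive_RInt_on (I : R -> Prop) (u : R -> R) (t0 t : R) :
  open I -> convex I -> (forall s, I s -> continuous u s) -> I t0 -> I t ->
  is_derive (fun s => RInt u t0 s) t (u t).
Proof.
  intros OI CI Hu It0 It. apply is_derive_RInt with (a := t0); [|auto].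
  apply filter_imp with (2 := OI t It). intros s Is.
  apply (RInt_correct (V := R_CompleteNormedModule)), ex_RInt_continuous.
  intros r Hr. apply Hu. unfold Rmin, Rmax in Hr.
  destruct (Rle_dec t0 s); [now apply (CI t0 s)|now apply (CI s t0)].
Qed.

(** The derivative [dg] serves to make [g] continuous. *)
Lemma primitive_exists (I : R -> Prop) (g dg : R -> C) (t0 : R) :
  open I -> convex I -> (forall s, I s -> rderiv g s (dg s)) -> I t0 ->
  exists G : R -> C, forall s, I s -> rderiv G s (g s).
Proof.
  intros OI CI Hg It0.
  exists (fun s => RtoC (RInt (fun r => Re (g r)) t0 s)
                   + Ci * RtoC (RInt (fun r => Im (g r)) t0 s)).
  intros s Is. apply rderiv_eq with (RtoC (Re (g s)) + Ci * RtoC (Im (g s))).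
  { destruct (g s) as [u v].
    unfold RtoC, Ci, Cplus, Cmult; simpl. f_equal; ring. }
  apply rderiv_plus; [|apply rderiv_scal]; apply rderiv_RtoC.
  - apply (is_derive_RInt_on I (fun r => Re (g r))); auto.
    intros r Ir. apply (rderiv_components_continuous g r (dg r)). auto.
  - apply (is_derive_RInt_on I (fun r => Im (g r))); auto.
    intros r Ir. apply (rderiv_components_continuous g r (dg r)). auto.
Qed.

(** [w exp (- G)] has derivative zero. *)
Lemma linear_solution (I : R -> Prop) (w g G : R -> C) (t0 t : R) :
  convex I -> (forall s, I s -> rderiv w s (g s * w s)) ->
  (forall s, I s -> rderiv G s (g s)) -> I t0 -> I t ->
  w t = w t0 * Cexp (G t - G t0).
Proof.
  intros CI Hw HG It0 It.
  assert (H : w t0 * Cexp (- (1) * G t0) = w t * Cexp (- (1) * G t)).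
  { apply (rderiv_0_const I (fun s => w s * Cexp (- (1) * G s))); auto.
    intros s Is.
    apply rderiv_eq with (g s * w s * Cexp (- (1) * G s)
                          + w s * (Cexp (- (1) * G s) * (- (1) * g s))); [ring|].
    apply rderiv_mult; auto.
    apply (rderiv_Cexp (fun s => - (1) * G s)), rderiv_scal. auto. }
  replace (G t - G t0) with (- (1) * G t0 + - (- (1) * G t)) by ring.
  rewrite Cexp_plus, Cexp_opp, Cmult_assoc, H. field. apply Cexp_neq_0.
Qed.

Lemma Cexp_periodic (eta : C) (s p : R) :
  Cexp (eta * p) = 1 -> Cexp (eta * (s + p)%R) = Cexp (eta * s).
Proof.
  intros H. rewrite RtoC_plus.
  replace (eta * (s + p)) with (eta * s + eta * p) by ring.
  rewrite Cexp_plus, H. ring.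
Qed.

(** [1 / w + E / eta] is constant, with [E = exp (eta s)].  A solution that vanishes
    once vanishes identically, as [w' = (E w) w] is a linear equation for [w]; so
    [1 / w] makes sense in the other case. *)
Lemma riccati_periodic (I : R -> Prop) (eta : C) (p : R) (w : R -> C) (s : R) :
  open I -> convex I -> eta <> 0 -> Cexp (eta * p) = 1 ->
  (forall s, I s -> rderiv w s (Cexp (eta * s) * w s ^ 2)) ->
  I s -> I (s + p)%R -> w (s + p)%R = w s.
Proof.
  intros OI CI He Hp Hw Is Isp.
  destruct (primitive_exists I (fun s => Cexp (eta * s) * w s)
    (fun s => eta * Cexp (eta * s) * w s
              + Cexp (eta * s) * (Cexp (eta * s) * w s ^ 2)) s OI CI) as [G HG].
  { intros r Ir. apply (rderiv_mult (fun s => Cexp (eta * s))); auto.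
    apply rderiv_Cexp_lin. }
  { exact Is. }
  assert (L : forall r, I r -> w r = w s * Cexp (G r - G s)).
  { intros r Ir.
    apply (linear_solution I w (fun s => Cexp (eta * s) * w s)); auto.
    intros q Iq. apply rderiv_eq with (2 := Hw q Iq). ring. }
  destruct (classic (w s = 0)) as [Z|N].
  { rewrite (L _ Isp), Z. ring. }
  assert (Nr : forall r, I r -> w r <> 0).
  { intros r Ir. rewrite (L r Ir). apply Cmult_neq_0; [exact N|].
    apply Cexp_neq_0. }
  assert (K : / w (s + p)%R + / eta * Cexp (eta * (s + p)%R)
              = / w s + / eta * Cexp (eta * s)).
  { apply (rderiv_0_const I (fun r => / w r + / eta * Cexp (eta * r))); auto.
    intros r Ir.
    apply rderiv_eq with (- / (w r * w r) * (Cexp (eta * r) * w r ^ 2)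
                          + / eta * (eta * Cexp (eta * r))).
    { field. auto. }
    apply rderiv_plus.
    - apply rderiv_inv; auto.
    - apply rderiv_scal, rderiv_Cexp_lin. }
  rewrite Cexp_periodic in K by exact Hp.
  assert (U : / w (s + p)%R = / w s).
  { replace (/ w s) with (/ w s + / eta * Cexp (eta * s)
                          - / eta * Cexp (eta * s)) by ring.
    rewrite <- K. ring. }
  replace (w (s + p)%R) with (/ / w (s + p)%R) by (field; auto).
  rewrite U. field. auto.
Qed.

(** * Periodicity of the solvable planar system *)

(** [y2 - v y1] satisfies a linear equation when [v] is a root of
    [v^2 + (rho2 - 1) v + rho1], and the coefficients of the equations for the two
    roots differ by [Delta] times the logarithmic derivative of [y1].  The
    hypothesis [Delta <> 0] makes it possible to recover [y1] from these two linear forms. *)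
Lemma planar_periodic (I : R -> Prop) (eta rho1 rho2 Delta : C) (p t : R)
    (k : nat) (k1 : Z) (y1 y2 : R -> C) :
  open I -> convex I -> eta <> 0 -> (0 <= p)%R -> Cexp (eta * p) = 1 ->
  Delta ^ 2 = (1 - rho2) ^ 2 - 4 * rho1 -> Delta <> 0 ->
  Delta * INR k = IZR k1 ->
  (forall s, I s -> rderiv y1 s (Cexp (eta * s) * y1 s ^ 2)) ->
  (forall s, I s -> rderiv y2 s
     (Cexp (eta * s) * (rho1 * y1 s ^ 2 + rho2 * (y1 s * y2 s) + y2 s ^ 2))) ->
  I t -> I (t + INR k * p)%R ->
  y1 (t + INR k * p)%R = y1 t /\ y2 (t + INR k * p)%R = y2 t.
Proof.
  intros OI CI He Hp HE HD ND Hk Hy1 Hy2 It IT.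
  set (E := fun s : R => Cexp (eta * s)).
  assert (HET : Cexp (eta * (INR k * p)%R) = 1).
  { rewrite RtoC_mult.
    replace (eta * (INR k * p)) with (INR k * (eta * p)) by ring.
    rewrite INR_IZR_INZ. now apply Cexp_Zmult. }
  assert (DE : forall s, rderiv E s (eta * E s)) by (intros; apply rderiv_Cexp_lin).
  assert (P1 : y1 (t + INR k * p)%R = y1 t).
  { apply (riccati_periodic I eta); auto. }
  split; [exact P1|].
  assert (DEw : forall w dw s, I s -> rderiv w s dw ->
            rderiv (fun s => E s * w s) s (eta * E s * w s + E s * dw)).
  { intros w dw s Is Hw. now apply rderiv_mult. }
  destruct (primitive_exists I (fun s => E s * y1 s) _ t OI CI
              (fun s Is => DEw y1 _ s Is (Hy1 s Is)) It) as [J HJ].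
  assert (L1 : forall s, I s -> y1 s = y1 t * Cexp (J s - J t)).
  { intros s Is. apply (linear_solution I y1 (fun s => E s * y1 s)); auto.
    intros q Iq. apply rderiv_eq with (2 := Hy1 q Iq). unfold E. ring. }
  destruct (classic (y1 t = 0)) as [Z|N].
  { apply (riccati_periodic I eta); auto.
    intros s Is. apply rderiv_eq with (2 := Hy2 s Is).
    rewrite (L1 s Is), Z. ring. }
  assert (Itj : forall j, (j <= k)%nat -> I (t + INR j * p)%R).
  { intros j Hj. apply (CI t (t + INR k * p)%R); auto.
    assert (0 <= INR j)%R by apply pos_INR.
    assert (INR j <= INR k)%R by now apply le_INR. nra. }
  (* the growth of the logarithm of [y1] over one turn of the circle *)
  set (m := J (t + p)%R - J t).
  assert (Jp : forall s, I s -> I (s + p)%R -> I (t + p)%R -> J (s + p)%R - J s = m).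
  { intros s Is Isp Itp. unfold m.
    set (I' := fun s => I s /\ I (s + p)%R).
    assert (H : J (s + p)%R + - (1) * J s = J (t + p)%R + - (1) * J t).
    { apply (rderiv_0_const I' (fun s => J (s + p)%R + - (1) * J s));
        unfold I'; auto.
      - intros a b r [Ha Ha'] [Hb Hb'] Hr. split.
        + now apply (CI a b).
        + apply (CI (a + p)%R (b + p)%R); auto. lra.
      - intros r [Ir Irp].
        apply rderiv_eq with (E (r + p)%R * y1 (r + p)%R + - (1) * (E r * y1 r)).
        + unfold E. rewrite Cexp_periodic by exact HE.
          rewrite (riccati_periodic I eta p y1 r); auto. ring.
        + apply rderiv_plus; [apply rderiv_shift|apply rderiv_scal]; auto. }
    replace (J (s + p)%R - J s) with (J (s + p)%R + - (1) * J s) by ring.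
    rewrite H. ring. }
  assert (Jj : forall j, (j <= k)%nat -> J (t + INR j * p)%R - J t = INR j * m).
  { induction j as [|j IH]; intros Hj.
    - simpl. rewrite Rmult_0_l, Rplus_0_r. ring.
    - specialize (IH ltac:(lia)).
      assert (I1 := Itj 1%nat ltac:(lia)). simpl in I1. rewrite Rmult_1_l in I1.
      assert (Ij := Itj j ltac:(lia)). assert (Ij' := Itj (S j) Hj).
      rewrite S_INR in *.
      replace (t + (INR j + 1) * p)%R with (t + INR j * p + p)%R in * by ring.
      rewrite RtoC_plus.
      replace (J (t + INR j * p + p)%R - J t)
        with ((J (t + INR j * p + p)%R - J (t + INR j * p)%R)
              + (J (t + INR j * p)%R - J t)) by ring.
      rewrite IH, Jp; auto. ring. }
  assert (Em : k <> 0%nat -> Cexp m = 1).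
  { intros Hk0. assert (I1 := Itj 1%nat ltac:(lia)).
    simpl in I1. rewrite Rmult_1_l in I1. unfold m.
    assert (H := L1 _ I1). rewrite (riccati_periodic I eta p y1 t) in H; auto.
    replace (Cexp (J (t + p)%R - J t))
      with (y1 t * Cexp (J (t + p)%R - J t) / y1 t) by (field; auto).
    rewrite <- H. field. auto. }
  destruct (Nat.eq_dec k 0) as [K0|K0].
  { rewrite K0. simpl. now rewrite Rmult_0_l, Rplus_0_r. }
  assert (ED : Cexp (Delta * (J (t + INR k * p)%R - J t)) = 1).
  { rewrite Jj by lia. rewrite Cmult_assoc, Hk. apply Cexp_Zmult. auto. }
  (* the linear forms that vanish on the invariant lines of slopes [vp], [vm] *)
  set (vp := (1 - rho2 + Delta) / 2). set (vm := (1 - rho2 - Delta) / 2).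
  set (Yp := fun s => y2 s + - vp * y1 s). set (Ym := fun s => y2 s + - vm * y1 s).
  assert (Er : rho1 = ((1 - rho2) ^ 2 - Delta ^ 2) / 4).
  { rewrite HD. field. }
  assert (DYp : forall s, I s -> rderiv Yp s (E s * (Ym s + y1 s) * Yp s)).
  { intros s Is.
    eapply rderiv_eq;
      [|apply rderiv_plus; [exact (Hy2 s Is)|exact (rderiv_scal (- vp) _ _ _ (Hy1 s Is))]].
    unfold Yp, Ym, vp, vm, E. rewrite Er. field. }
  assert (DYm : forall s, I s -> rderiv Ym s (E s * (Yp s + y1 s) * Ym s)).
  { intros s Is.
    eapply rderiv_eq;
      [|apply rderiv_plus; [exact (Hy2 s Is)|exact (rderiv_scal (- vm) _ _ _ (Hy1 s Is))]].
    unfold Yp, Ym, vp, vm, E. rewrite Er. field. }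
  assert (DYp1 : forall s, I s -> rderiv (fun s => Yp s + y1 s) s
            (E s * (Ym s + y1 s) * Yp s + Cexp (eta * s) * y1 s ^ 2)).
  { intros s Is. apply rderiv_plus; auto. }
  destruct (primitive_exists I (fun s => E s * (Yp s + y1 s)) _ t OI CI
              (fun s Is => DEw _ _ s Is (DYp1 s Is)) It) as [M HM].
  assert (LYm : Ym (t + INR k * p)%R = Ym t * Cexp (M (t + INR k * p)%R - M t)).
  { apply (linear_solution I Ym (fun s => E s * (Yp s + y1 s))); auto. }
  assert (LYp : Yp (t + INR k * p)%R = Yp t * Cexp (M (t + INR k * p)%R - M t)).
  { assert (H : Yp (t + INR k * p)%R = Yp t *
       Cexp ((M (t + INR k * p)%R + Delta * J (t + INR k * p)%R)
             - (M t + Delta * J t))).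
    { apply (linear_solution I Yp (fun s => E s * (Ym s + y1 s))
               (fun s => M s + Delta * J s)); auto.
      intros s Is.
      apply rderiv_eq with (E s * (Yp s + y1 s) + Delta * (E s * y1 s)).
      - unfold Yp, Ym, vp, vm. field.
      - apply rderiv_plus; [|apply rderiv_scal]; auto. }
    rewrite H. f_equal.
    replace (M (t + INR k * p)%R + Delta * J (t + INR k * p)%R - (M t + Delta * J t))
      with ((M (t + INR k * p)%R - M t) + Delta * (J (t + INR k * p)%R - J t)) by ring.
    rewrite Cexp_plus, ED. ring. }
  (* [y1] is proportional to the difference of the two linear forms *)
  set (T := (t + INR k * p)%R) in *.
  assert (Y1 : forall s, y1 s = (Ym s - Yp s) / Delta).
  { intros s. unfold Ym, Yp, vp, vm. field. auto. }
  assert (EM : Cexp (M T - M t) = 1).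
  { replace (Cexp (M T - M t)) with (y1 t * Cexp (M T - M t) / y1 t) by (field; auto).
    rewrite (Y1 t) at 1.
    replace ((Ym t - Yp t) / Delta * Cexp (M T - M t))
      with ((Ym t * Cexp (M T - M t) - Yp t * Cexp (M T - M t)) / Delta)
      by (field; auto).
    rewrite <- LYm, <- LYp, <- Y1, P1. field. auto. }
  assert (Y2 : forall s, y2 s = Yp s + vp * y1 s) by (intros; unfold Yp; ring).
  rewrite !Y2, LYp, EM, P1. ring.
Qed.

(** * Isochrony *)

(** The change of variables undone at each real time [s], with [s] kept as the
    time: this obeys (S) with the right-hand side multiplied by [exp (eta s)]. *)
Definition untwisted (zbar : I2 -> C) (eta : C) (z : I2 -> R -> C) (n : I2) (s : R) : C :=
  Cexp (- eta * s) * (z n s + - zbar n).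

Lemma retwist (zbar : I2 -> C) (eta : C) (z : I2 -> R -> C) (n : I2) (s : R) :
  z n s = Cexp (eta * s) * untwisted zbar eta z n s + zbar n.
Proof.
  unfold untwisted. replace (- eta * s) with (- (eta * s)) by ring.
  rewrite Cexp_opp. field. apply Cexp_neq_0.
Qed.

Lemma rhsZ_ext (c : I2 -> I3 -> C) (zbar : I2 -> C) (eta : C) (z z' : I2 -> C) (n : I2) :
  (forall m, z m = z' m) -> rhsZ c zbar eta z n = rhsZ c zbar eta z' n.
Proof. intros H. unfold rhsZ. now rewrite !H. Qed.

Lemma untwisted_rderiv (c : I2 -> I3 -> C) (zbar : I2 -> C) (eta : C)
    (z : I2 -> R -> C) (n : I2) (s : R) :
  solves_at_real (rhsZ c zbar eta) z s ->
  rderiv (untwisted zbar eta z n) s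
    (Cexp (eta * s) * rhsS c (fun m => untwisted zbar eta z m s) n).
Proof.
  intros Hz. assert (D := proj1 (is_derive_rderiv _ _ _) (Hz n)).
  rewrite (rhsZ_ext c zbar eta _ _ n (fun m => retwist zbar eta z m s)),
    rhsZ_change in D.
  set (E := Cexp (eta * s)) in *. set (F := rhsS c _ n) in *.
  assert (NE : E <> 0) by apply Cexp_neq_0.
  assert (EE : Cexp (- eta * s) = / E).
  { unfold E. rewrite <- Cexp_opp. f_equal. ring. }
  eapply rderiv_eq;
    [|apply rderiv_mult;
      [apply rderiv_Cexp_lin|apply rderiv_plus; [exact D|apply rderiv_const]]].
  cbv beta. unfold untwisted. rewrite EE. field. exact NE.
Qed.

(** [coefC] is made so that (S) becomes the solvable system in the coordinates
    [y]. *)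
Lemma rhsS_conjugate (c : I2 -> I3 -> C) (rho1 rho2 : C) (b : I2 -> I2 -> C)
    (x : I2 -> C) (n : I2) :
  (forall n l, c n l = coefC rho1 rho2 b n l) ->
  let y m := matA b m n1 * x n1 + matA b m n2 * x n2 in
  rhsS c x n = b n n1 * y n1 ^ 2
    + b n n2 * (rho1 * y n1 ^ 2 + rho2 * (y n1 * y n2) + y n2 ^ 2).
Proof.
  intros Hc y. unfold rhsS. rewrite !Hc. unfold coefC, y.
  generalize (matA b n1 n1) (matA b n1 n2) (matA b n2 n1) (matA b n2 n2).
  intros. ring.
Qed.

Lemma matA_left (b : I2 -> I2 -> C) (u : I2 -> C) (m : I2) :
  b n1 n1 * b n2 n2 - b n1 n2 * b n2 n1 <> 0 ->
  matA b m n1 * (b n1 n1 * u n1 + b n1 n2 * u n2)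
  + matA b m n2 * (b n2 n1 * u n1 + b n2 n2 * u n2) = u m.
Proof. intros HB. destruct m; simpl; field; exact HB. Qed.

Lemma matA_right (b : I2 -> I2 -> C) (x : I2 -> C) (n : I2) :
  b n1 n1 * b n2 n2 - b n1 n2 * b n2 n1 <> 0 ->
  x n = b n n1 * (matA b n1 n1 * x n1 + matA b n1 n2 * x n2)
        + b n n2 * (matA b n2 n1 * x n1 + matA b n2 n2 * x n2).
Proof. intros HB. destruct n; simpl; field; exact HB. Qed.

(** A solution near the real axis on one side gives solutions in a real time on
    the lines of constant small imaginary part, because the equation is
    autonomous; by compactness one such line serves for a whole period.  Its
    regularity at the two real times makes the passage to the limit possible. *)
Lemma continued_periodic (f : (I2 -> C) -> I2 -> C) (T : R) : (0 <= T)%R ->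
  (forall (a b : Rbar) (z : I2 -> R -> C),
     (forall t : R, Rbar_lt a t -> Rbar_lt t b -> solves_at_real f z t) ->
     forall t : R, Rbar_lt a t -> Rbar_lt (t + T)%R b ->
     forall n, z n (t + T)%R = z n t) ->
  isochronous f T.
Proof.
  intros HT Hreal. split; [exact Hreal|].
  intros sg z Hsg Hz t Ht HtT n.
  set (rad := fun s => proj1_sig (constructive_indefinite_description _ (Hz s))).
  assert (Hrad : forall s, (0 < rad s)%R /\ forall w : C, opendisc s (rad s) w ->
            (0 < sg * Im w)%R -> solves_at f z w).
  { intros s. exact (proj2_sig (constructive_indefinite_description _ (Hz s))). }
  set (del := fun s => mkposreal (rad s / 2)
                (Rdiv_lt_0_compat _ _ (proj1 (Hrad s)) Rlt_0_2)).
  destruct (compactness_value_1d (t - 1) (t + T + 1) del) as [d Hd].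
  (* the strip of height [d] lies in the union of the half discs *)
  assert (Strip : forall s y : R, (t - 1 < s < t + T + 1)%R -> (Rabs y < d)%R ->
            (0 < sg * y)%R -> solves_at f z (s, y)).
  { intros s y Hs Hy Hsy. apply NNPP. intro HN. apply (Hd s); [lra|].
    intros (q & _ & Hq & Hdq). apply HN. apply (proj2 (Hrad q)); [|exact Hsy].
    unfold opendisc. eapply Rle_lt_trans; [apply Cmod_le_components|].
    unfold del in Hq, Hdq. simpl in *. unfold Rminus in Hq.
    rewrite Ropp_0, Rplus_0_r. lra. }
  assert (Per : forall y : R, (Rabs y < d)%R -> (0 < sg * y)%R ->
            z n ((t + T)%R, y) = z n (t, y)).
  { intros y Hy Hsy.
    apply (Hreal (t - 1)%R (t + T + 1)%R (fun m s => z m (s, y))); simpl; [|lra|lra].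
    intros s H1 H2 m. apply is_derive_rderiv.
    assert (D := proj1 (is_derive_C_anywhere _ _ _) (Strip s y (conj H1 H2) Hy Hsy m)).
    rewrite <- (Cmult_1_r (f _ _)).
    assert (Ev : forall q : C, on_reals q -> q + (0, y)%R = (Re q, y)).
    { intros [u v] Sq. unfold on_reals in Sq. simpl in Sq.
      unfold Cplus; simpl. rewrite Sq. f_equal; ring. }
    assert (E0 : RtoC s + (0, y)%R = (s, y)) by now apply Ev.
    rewrite <- E0 in D.
    apply deriv_in_ext with (f := fun w => z m (w + (0, y)%R))
      (l := f (fun k => z k (RtoC s + (0, y)%R)) m * (1 + 0)).
    - intros w Sw. now rewrite Ev.
    - now rewrite E0.
    - rewrite E0. ring.
    - apply (deriv_in_comp on_reals anywhere (fun w => w + (0, y)%R) (z m)).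
      + intros; exact I.
      + apply deriv_in_plus; [apply deriv_in_id|apply deriv_in_const].
      + exact D. }
  (* let [y] tend to 0 *)
  assert (C0 : forall s : R, solves_at f z s -> tends anywhere (z n) s (z n s)).
  { intros s Hs. apply deriv_in_tends with (l := f (fun m => z m s) n).
    apply is_derive_C_anywhere, Hs. }
  apply NNPP. intro HN.
  assert (Hgap : z n (t + T)%R - z n t <> 0).
  { intro A. apply HN. replace (z n (t + T)%R) with (z n (t + T)%R - z n t + z n t) by ring.
    now rewrite A, Cplus_0_l. }
  apply Cmod_gt_0 in Hgap. set (e := (Cmod (z n (t + T)%R - z n t) / 2)%R).
  assert (He : (0 < e)%R) by (unfold e; lra).
  destruct (C0 t Ht e He) as [d1 [Hd1 H1]].
  destruct (C0 _ HtT e He) as [d2 [Hd2 H2]].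
  set (h := (Rmin d (Rmin d1 d2) / 2)%R).
  assert (Ph := cond_pos d).
  assert (Pm : (0 < Rmin d (Rmin d1 d2))%R) by (repeat apply Rmin_glb_lt; lra).
  assert (M1 := Rmin_l d (Rmin d1 d2)). assert (M2 := Rmin_r d (Rmin d1 d2)).
  assert (M3 := Rmin_l d1 d2). assert (M4 := Rmin_r d1 d2).
  assert (Hy : exists y : R, (Rabs y = h)%R /\ (0 < sg * y)%R).
  { destruct (Rtotal_order sg 0) as [L|[L|L]].
    - exists (- h)%R. split; [rewrite Rabs_Ropp; apply Rabs_pos_eq|]; unfold h; nra.
    - contradiction.
    - exists h. split; [apply Rabs_pos_eq|]; unfold h; nra. }
  destruct Hy as [y [Hy1 Hy2]].
  assert (Near : forall s : R, (Cmod ((s, y) - s) <= h)%R).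
  { intros s. eapply Rle_trans; [apply Cmod_le_components|]. simpl.
    rewrite Rplus_opp_r, Ropp_0, Rplus_0_r, Rabs_R0, Hy1. lra. }
  specialize (H1 (t, y) I ltac:(eapply Rle_lt_trans; [apply Near|unfold h; lra])).
  specialize (H2 ((t + T)%R, y) I ltac:(eapply Rle_lt_trans; [apply Near|unfold h; lra])).
  rewrite (Per y) in H2 by (auto; rewrite Hy1; unfold h; lra).
  assert (A := Cmod_triangle (z n (t, y) - z n t) (- (z n (t, y) - z n (t + T)%R))).
  rewrite Cmod_opp in A.
  replace (z n (t, y) - z n t + - (z n (t, y) - z n (t + T)%R))
    with (z n (t + T)%R - z n t) in A by ring.
  unfold e in *. lra.
Qed.

Lemma Rbar_interval_open (a b : Rbar) :
  open (fun s : R => Rbar_lt a s /\ Rbar_lt s b).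
Proof. apply open_and; [apply open_Rbar_gt|apply open_Rbar_lt]. Qed.

Lemma Rbar_interval_convex (a b : Rbar) :
  convex (fun s : R => Rbar_lt a s /\ Rbar_lt s b).
Proof.
  intros u v s [Hu _] [_ Hv] [H1 H2]. split.
  - now apply Rbar_lt_le_trans with u.
  - now apply Rbar_le_lt_trans with v.
Qed.

Lemma Cexp_turn (omega : R) : omega <> 0%R ->
  Cexp (Ci * omega * (2 * PI / Rabs omega)%R) = 1.
Proof.
  intros Ho.
  replace (Ci * omega * (2 * PI / Rabs omega)%R)
    with ((0, omega * (2 * PI / Rabs omega))%R : C)
    by (unfold Ci, RtoC, Cmult; simpl; f_equal; ring).
  unfold Cexp; simpl. rewrite exp_0.
  assert (E : (cos (omega * (2 * PI / Rabs omega)) = 1 /\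
               sin (omega * (2 * PI / Rabs omega)) = 0)%R).
  { unfold Rabs. destruct (Rcase_abs omega).
    - replace (omega * (2 * PI / - omega))%R with (- (2 * PI))%R by (field; lra).
      rewrite cos_neg, sin_neg, cos_2PI, sin_2PI. lra.
    - replace (omega * (2 * PI / omega))%R with (2 * PI)%R by (field; lra).
      rewrite cos_2PI, sin_2PI. lra. }
  destruct E as [-> ->]. unfold RtoC. f_equal; ring.
Qed.

Lemma rhsZ_isochronous (c : I2 -> I3 -> C) (zbar : I2 -> C) (eta : C)
    (rho1 rho2 : C) (b : I2 -> I2 -> C) (Delta : C) (k1 k2 : Z) (omega : R) :
  b n1 n1 * b n2 n2 - b n1 n2 * b n2 n1 <> 0 ->
  (forall n l, c n l = coefC rho1 rho2 b n l) ->
  Delta ^ 2 = (1 - rho2) ^ 2 - 4 * rho1 ->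
  Delta = (IZR k1 / IZR k2)%R ->
  (0 < k2)%Z -> k1 <> 0%Z -> omega <> 0%R -> eta = Ci * omega ->
  isochronous (rhsZ c zbar eta) (2 * PI * IZR k2 / Rabs omega)%R.
Proof.
  intros HB Hc HD HDk Hk2 Hk1 Ho Heta.
  assert (Po := Rabs_pos_lt omega Ho). assert (PP := PI_RGT_0).
  assert (Rk2 : (0 < IZR k2)%R) by now apply IZR_lt.
  assert (Ek : INR (Z.to_nat k2) = IZR k2).
  { rewrite INR_IZR_INZ, Z2Nat.id by lia. reflexivity. }
  assert (Pp : (0 < 2 * PI / Rabs omega)%R) by (apply Rdiv_lt_0_compat; lra).
  set (p := (2 * PI / Rabs omega)%R) in *.
  replace (2 * PI * IZR k2 / Rabs omega)%R with (INR (Z.to_nat k2) * p)%R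
    by (rewrite Ek; unfold p; field; lra).
  set (T := (INR (Z.to_nat k2) * p)%R).
  assert (He : eta <> 0).
  { rewrite Heta. intro A. apply Ho. injection A. intros A1 A2. lra. }
  assert (Hp : Cexp (eta * p) = 1) by (rewrite Heta; now apply Cexp_turn).
  assert (HpT : Cexp (eta * T) = 1).
  { unfold T. rewrite RtoC_mult, Ek.
    replace (eta * (IZR k2 * p)) with (IZR k2 * (eta * p)) by ring.
    now apply Cexp_Zmult. }
  apply continued_periodic; [unfold T; rewrite Ek; nra|].
  intros a b' z Hz t Ht HtT.
  set (I := fun s : R => Rbar_lt a s /\ Rbar_lt s b').
  assert (HT0 : (0 <= T)%R) by (unfold T; rewrite Ek; nra).
  assert (It : I t).
  { split; [exact Ht|]. apply Rbar_le_lt_trans with (2 := HtT). simpl. lra. }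
  assert (IT : I (t + T)%R).
  { split; [|exact HtT]. apply Rbar_lt_le_trans with (1 := Ht). simpl. lra. }
  set (x := untwisted zbar eta z).
  set (y := fun m s => matA b m n1 * x n1 s + matA b m n2 * x n2 s).
  assert (Dy : forall m s, I s -> rderiv (y m) s
     (Cexp (eta * s) * match m with
        | n1 => y n1 s ^ 2
        | n2 => rho1 * y n1 s ^ 2 + rho2 * (y n1 s * y n2 s) + y n2 s ^ 2
        end)).
  { intros m s [Is Is'].
    assert (Dx : forall n, rderiv (x n) s
              (Cexp (eta * s) * rhsS c (fun k => x k s) n)).
    { intros n. apply untwisted_rderiv. now apply Hz. }
    eapply rderiv_eq;
      [|apply rderiv_plus; apply rderiv_scal; apply Dx].
    rewrite !(rhsS_conjugate c rho1 rho2 b _ _ Hc). fold (y n1 s) (y n2 s).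
    rewrite <- (matA_left b (fun m => match m with
        | n1 => y n1 s ^ 2
        | n2 => rho1 * y n1 s ^ 2 + rho2 * (y n1 s * y n2 s) + y n2 s ^ 2
        end) m HB). ring. }
  destruct (planar_periodic I eta rho1 rho2 Delta p t (Z.to_nat k2) k1
              (y n1) (y n2)) as [Y1 Y2]; auto.
  - apply Rbar_interval_open.
  - apply Rbar_interval_convex.
  - lra.
  - rewrite HDk. intro A. apply RtoC_inj in A.
    assert (N : IZR k1 <> 0%R) by now apply not_0_IZR.
    apply N. replace (IZR k1) with (IZR k1 / IZR k2 * IZR k2)%R by (field; lra).
    rewrite A. ring.
  - rewrite HDk, Ek, <- RtoC_mult. f_equal. field. lra.
  - fold T in Y1, Y2. intros n.
    rewrite !(retwist zbar eta z n), Cexp_periodic by exact HpT. f_equal. f_equal.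
    fold x. rewrite (matA_right b (fun k => x k (t + T)%R) n HB).
    rewrite (matA_right b (fun k => x k t) n HB).
    fold (y n1 (t + T)%R) (y n2 (t + T)%R) (y n1 t) (y n2 t).
    now rewrite Y1, Y2.
Qed.

Theorem mainTheorem4 :
  (* (i) the change of variables, for complex and for real times *)
  (forall (c : I2 -> I3 -> C) (zbar : I2 -> C) (eta : C), eta <> 0 ->
     (forall (x : I2 -> C -> C) (t : C),
        solves_at (rhsS c) x (ttilde eta t) <->
        solves_at (rhsZ c zbar eta) (change zbar eta x) t) /\
     (forall (x : I2 -> C -> C) (t : R),
        (forall n, ex_derive (K := C_AbsRing) (V := C_NormedModule)
                     (x n) (ttilde eta t)) ->
        (solves_at (rhsS c) x (ttilde eta t) <->
         solves_at_real (rhsZ c zbar eta)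
           (fun n (s : R) => change zbar eta x n s) t)) /\
     (* its local invertibility *)
     (forall (z : I2 -> C -> C) (t0 : C),
        exists (x : I2 -> C -> C) (r : R), (0 < r)%R /\
          forall n t, opendisc t0 r t -> z n t = change zbar eta x n t)) /\
  (* (i) solvability carries over *)
  (forall D : (parS -> C) -> (I2 -> C) -> Prop,
     solvable familyS D -> solvable familyZ (dataZ D)) /\
  (* (ii); for [Delta = 0] the solutions involve a logarithm and the claim
     fails, see the example z1 = -i, z2 = -1/(t + i) of
     z1' = z1^2 + i z1, z2' = z1 z2 + z2^2 + i z2 (rho1 = 0, rho2 = 1) *)
  (forall (c : I2 -> I3 -> C) (zbar : I2 -> C) (eta : C)
          (rho1 rho2 : C) (b : I2 -> I2 -> C)
          (Delta : C) (k1 k2 : Z) (omega : R),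
     b n1 n1 * b n2 n2 - b n1 n2 * b n2 n1 <> 0 ->
     (forall n l, c n l = coefC rho1 rho2 b n l) ->
     Delta ^ 2 = (1 - rho2) ^ 2 - 4 * rho1 ->
     Delta = (IZR k1 / IZR k2)%R ->
     (0 < k2)%Z ->
     k1 <> 0%Z ->
     omega <> 0%R ->
     eta = Ci * omega ->
     isochronous (rhsZ c zbar eta) (2 * PI * IZR k2 / Rabs omega)%R).
Proof.
  split; [|split].
  - intros c zbar eta He. split; [|split].
    + intros x t. split; [now apply change_solves|now apply change_solves_inv].
    + intros x t. now apply change_solves_real.
    + intros z t0. now apply change_locally_onto.
  - exact solvable_change.
  - exact rhsZ_isochronous.
Qed.
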